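(* Let $\epsilon\in(0,\infty)$, $\alpha\in[0,1)$, $\beta\in(\alpha^2,1)$, and let $(\gamma_n)_{n\in\mathbb N}\subseteq(0,\infty)$ be a non-summable decreasing sequence converging to zero which satisfies $\sup_{\varepsilon\in(0,\infty)}\liminf_{n\to\infty}\bigl((\gamma_n)^{-1}\gamma_{n+\lceil(\gamma_n)^{-1}\varepsilon\rceil}\bigr)>0$. Let $p\in[2,\infty)$, $d\in\mathbb N$, $\vartheta\in\mathbb R^d$, let $(X,U)$ be a locally $p$-regular innovation, let $(\theta_n)_{n\in\mathbb N_0}$ be the Adam algorithm with innovation $(X,U)$, step-sizes $(\gamma_n)_{n\in\mathbb N}$ and damping parameters $(\alpha,\beta,\epsilon)$ started in $\vartheta$, and let $f$ be the corresponding Adam vector field. Let $\theta_\infty$ be an $\mathbb R^d$-valued random variable and let $\Omega_0$ be an event such that for all $\varepsilon\in(0,\infty)$ $$\lim_{n\to\infty}\mathbb P\bigl(\{|\theta_n-\theta_\infty|\ge\varepsilon\}\cap\Omega_0\bigr)=0 .$$ Then $$\mathbb P\bigl(\{f(\theta_\infty)\ne0\}\cap\Omega_0\bigr)=0 .$$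
   Context: Innovation: a pair $(X,U)$ where $U$ is a random variable on a probability space $(\Omega,\mathcal F,\mathbb P)$ with values in a measurable space $\mathcal U$ and $X:\mathcal U\times\mathbb R^d\to\mathbb R^d$ is product measurable. $X^{(j)}$ is the $j$-th component. For $p\in[2,\infty)$, $(X,U)$ is locally $p$-regular if there is a continuous $c:\mathbb R\to\mathbb R$ such that for all $\theta,\vartheta\in\mathbb R^d$: $\mathbb E[|X(U,\theta)|^p]\le c(0)(1+e^{c(0)|\theta|})$ and $\mathbb E[|X(U,\theta)-X(U,\vartheta)|^p]\le c(|\theta|+|\vartheta|)\,|\theta-\vartheta|^p$. Adam algorithm with innovation $(X,U)$, step-sizes $(\gamma_n)_{n\in\mathbb N}$, damping parameters $(\alpha,\beta,\epsilon)$, started in $\vartheta$: a process $(\theta_n)_{n\in\mathbb N_0}$ in $\mathbb R^d$ for which there are i.i.d. copies $U_1,U_2,\dots$ of $U$ such that $\theta_0=\vartheta$, $m_0=v_0=0\in\mathbb R^d$, and for all $n\in\mathbb N$, $j\in\{1,\dots,d\}$: $$m_n=\alpha m_{n-1}+(1-\alpha)X(U_n,\theta_{n-1}),\quad v_n^{(j)}=\beta v_{n-1}^{(j)}+(1-\beta)(X^{(j)}(U_n,\theta_{n-1}))^2,$$ $$\sigma_n^{(j)}=\bigl(\sqrt{v_n^{(j)}/(1-\beta^n)}+\epsilon\bigr)^{-1},\quad \theta_n^{(j)}=\theta_{n-1}^{(j)}+\gamma_n\sigma_n^{(j)}m_n^{(j)}.$$ Adam vector field $f=(f^{(1)},\dots,f^{(d)}):\mathbb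 R^d\to\mathbb R^d$ of $(X,U)$ with damping parameters $(\alpha,\beta,\epsilon)$: with $(U_k)_{k\in\mathbb Z,k\le0}$ i.i.d. copies of $U$ (and $0^0=1$), $$f^{(j)}(\theta)=(1-\alpha)\,\mathbb E\Bigl[\Bigl(\Bigl[(1-\beta)\sum_{k=-\infty}^0\beta^{-k}|X^{(j)}(U_k,\theta)|^2\Bigr]^{1/2}+\epsilon\Bigr)^{-1}\sum_{k=-\infty}^0\alpha^{-k}X^{(j)}(U_k,\theta)\Bigr].$$ *)

(* Defs.v *)
From HB Require Import structures.
From mathcomp Require Import all_boot all_order all_algebra.
From mathcomp Require Import finmap.
From mathcomp Require Import all_classical all_reals all_analysis.

Set Implicit Arguments.
Unset Strict Implicit.
Unset Printing Implicit Defensive.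

Import Order.TTheory GRing.Theory Num.Theory.
Import numFieldNormedType.Exports.

Local Open Scope classical_set_scope.
Local Open Scope ring_scope.

Definition measure_rV_display : measure_display.
Proof. exact. Qed.

(* R^d carries the sigma-algebra generated by the coordinates, as the library
   does for d.-tuple R. It is the Borel sigma-algebra, see rV_measurableE. *)
Section measurable_rV.
Context {R : realType} {d : nat}.

Let coors : 'I_d -> 'rV[R]_d -> measurableTypeR R := fun i x => x ord0 i.

Let rV_set0 : g_sigma_preimage coors set0.
Proof. exact: sigma_algebra0. Qed.

Let rV_setC A : g_sigma_preimage coors A -> g_sigma_preimage coors (~` A).
Proof. exact: sigma_algebraC. Qed.

Let rV_bigcup (F : (set 'rV[R]_d)^nat) :
  (forall i, g_sigma_preimage coors (F i)) ->
  g_sigma_preimage coors (\bigcup_i (F i)).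
Proof. exact: sigma_algebra_bigcup. Qed.

HB.instance Definition _ := @isMeasurable.Build measure_rV_display
  'rV[R]_d (g_sigma_preimage coors) rV_set0 rV_setC rV_bigcup.

End measurable_rV.

Lemma measurable_rV_coord (R : realType) (d : nat) (i : 'I_d) :
  measurable_fun [set: 'rV[R]_d] (fun x : 'rV[R]_d => x ord0 i).
Proof.
move=> _ Y mY; rewrite setTI; apply: sub_sigma_algebra => /=.
rewrite -bigcup_seq/=; exists i => /=; first by rewrite mem_index_enum.
by exists Y => //; rewrite setTI.
Qed.

Lemma rV_measurableE (R : realType) (d : nat) :
  @measurable _ 'rV[R]_d = <<s [set A : set 'rV[R]_d | open A] >>.
Proof.
apply/seteqP; split.
  apply: smallest_sub; first exact: smallest_sigma_algebra.
  rewrite -bigcup_seq; apply: bigcup_sub => i _ _ [B mB <-]; rewrite setTI.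
  have : <<s @measurable_realfun.RGenOpens.G R >> B.
    by move: mB; rewrite [X in X B](@measurable_realfun.RGenOpens.measurableE R).
  clear mB; move: B.
  apply: (@smallest_sub _ (sigma_algebra setT) (@measurable_realfun.RGenOpens.G R)
    [set C | <<s [set A : set 'rV[R]_d | open A] >> ((fun x : 'rV[R]_d => x ord0 i) @^-1` C)]).
    split => /=.
    - by rewrite preimage_set0; exact: sigma_algebra0.
    - by move=> A; rewrite !setTD preimage_setC; exact: sigma_algebraC.
    - by move=> F mF; rewrite preimage_bigcup; exact: sigma_algebra_bigcup.
  move=> _ [x [y ->]] /=; apply: sub_sigma_algebra => /=.
  apply: open_comp => [? _|]; first exact: coord_continuous.
  exact: itv_open.
apply: smallest_sub; first by split; [exact: measurable0|move=> A mA; rewrite setTD; exact: measurableC|exact: bigcupT_measurable].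
move=> A oA /=.
pose box (q : 'rV[rat]_d * 'rV[rat]_d) : set 'rV[R]_d :=
  [set x | forall i, x ord0 i \in `]ratr (q.1 ord0 i), ratr (q.2 ord0 i)[].
have -> : A = \bigcup_(q in [set q | box q `<=` A]) box q.
  apply/seteqP; split; last by apply: bigcup_sub.
  move=> x Ax; have /nbhs_ballP[e /= e0 xeA] := open_nbhs_nbhs (conj oA Ax).
  have h1 i : {q : rat | ratr q \in `](x ord0 i - e), (x ord0 i)[}.
    by apply/cid; apply: rat_in_itvoo; rewrite ltrBlDr ltrDl.
  have h2 i : {q : rat | ratr q \in `](x ord0 i), (x ord0 i + e)[}.
    by apply/cid; apply: rat_in_itvoo; rewrite ltrDl.
  exists (\row_i sval (h1 i), \row_i sval (h2 i)); last first.
    move=> i /=; rewrite !mxE in_itv/=.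
    by case: (h1 i) (h2 i) => [q /= +] [r /=]; rewrite !in_itv/= => /andP[_ ->] /andP[->].
  move=> y /= yb; apply: xeA; split => // a i; rewrite ord1 /ball/=.
  have := yb i; rewrite !mxE /= in_itv/=.
  case: (h1 i) (h2 i) => [q /= +] [r /=]; rewrite !in_itv/= => /andP[a1 a2] /andP[a3 a4] /andP[a5 a6].
  rewrite ltr_distlC; apply/andP; split; [exact: lt_trans a5|exact: lt_trans a4].
have -> : \bigcup_(q in [set q | box q `<=` A]) box q = \bigcup_q (if `[< box q `<=` A >] then box q else set0).
  apply/seteqP; split=> [x [q qA qx]|x [q _]]; first by exists q => //; rewrite asboolT.
  by case: asboolP => [? ?|_ []]; exists q.
apply: countable_bigcupT_measurable => [|q]; first exact: countableP.
case: asboolP => // _.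
rewrite (_ : box q = \bigcap_(i in [set: 'I_d]) [set x | x ord0 i \in
    `]ratr (q.1 ord0 i), ratr (q.2 ord0 i)[]); last first.
  by apply/seteqP; split=> [x qx i _|x qx i]; exact: qx.
apply: fin_bigcap_measurable => // i _.
have := @measurable_rV_coord R d i measurableT _
  (measurable_itv `]ratr (q.1 ord0 i), ratr (q.2 ord0 i)[).
by rewrite setTI.
Qed.

(* The norm `|x| that the library puts on 'rV[R]_d is the sup norm. *)
Definition enorm (R : realType) (d : nat) (x : 'rV[R]_d) : R :=
  Num.sqrt (\sum_(j < d) (x ord0 j) ^+ 2).

Section iid.
Context {R : realType} {dS : measure_display} {S : measurableType dS}.

Definition mutually_independent (dO : measure_display)
    (Omega : measurableType dO) (P : probability Omega R) (I : choiceType)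
    (V : I -> {RV P >-> S}) : Prop :=
  forall (J : {fset I}) (B : I -> set S),
    (forall i, i \in J -> measurable (B i)) ->
    P (\bigcap_(i in [set` J]) (V i @^-1` B i)) =
    (\prod_(i <- J) P (V i @^-1` B i))%E.

Definition same_law (dO : measure_display) (Omega : measurableType dO)
    (P : probability Omega R) (U : {RV P >-> S})
    (dO' : measure_display) (Omega' : measurableType dO')
    (P' : probability Omega' R) (V : {RV P' >-> S}) : Prop :=
  forall B : set S, measurable B -> distribution P' V B = distribution P U B.

Definition iid_copies (dO : measure_display) (Omega : measurableType dO)
    (P : probability Omega R) (U : {RV P >-> S})
    (dO' : measure_display) (Omega' : measurableType dO')
    (P' : probability Omega' R) (I : choiceType)
    (V : I -> {RV P' >-> S}) : Prop :=
  mutually_independent V /\ forall i, same_law U (V i).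

End iid.

Section adam.
Context {R : realType} {dS : measure_display} {S : measurableType dS}
  {d : nat} {dO : measure_display} {Omega : measurableType dO}
  {P : probability Omega R}.

Definition locally_regular (p : R)
    (X : {mfun (S * 'rV[R]_d)%type >-> 'rV[R]_d}) (U : {RV P >-> S}) : Prop :=
  exists c : R -> R, continuous c /\
    forall theta vartheta : 'rV[R]_d,
      ('E_P[(fun w => enorm (X (U w, theta)) `^ p)%R]
         <= (c 0 * (1 + expR (c 0 * enorm theta)))%:E)%E /\
      ('E_P[(fun w => enorm (X (U w, theta) - X (U w, vartheta)) `^ p)%R]
         <= (c (enorm theta + enorm vartheta)
             * enorm (theta - vartheta) `^ p)%:E)%E.

(* The i.i.d. copies are shifted by one: V n is U_(n+1). The step sizes are not:
   gamma 0 is never used. *)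
Definition adam_algorithm (X : {mfun (S * 'rV[R]_d)%type >-> 'rV[R]_d})
    (U : {RV P >-> S}) (gamma : nat -> R) (alpha beta epsilon : R)
    (vartheta : 'rV[R]_d) (theta : nat -> Omega -> 'rV[R]_d) : Prop :=
  exists (V : nat -> {RV P >-> S}) (m v sigma : nat -> Omega -> 'rV[R]_d),
    [/\ iid_copies U V,
        forall w, [/\ theta 0%N w = vartheta, m 0%N w = 0 & v 0%N w = 0] &
        forall (n : nat) (w : Omega),
          m n.+1 w = alpha *: m n w + (1 - alpha) *: X (V n w, theta n w) /\
          forall j : 'I_d,
          [/\ v n.+1 w ord0 j = beta * v n w ord0 j
                + (1 - beta) * (X (V n w, theta n w) ord0 j) ^+ 2,
              sigma n.+1 w ord0 j =
                (Num.sqrt (v n.+1 w ord0 j / (1 - beta ^+ n.+1)) + epsilon)^-1 &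
              theta n.+1 w ord0 j = theta n w ord0 j
                + gamma n.+1 * sigma n.+1 w ord0 j * m n.+1 w ord0 j]].

(* The copies (U_k)_(k <= 0) are reindexed by nat: V k is U_(-k). They may live
   on any probability space, since f only depends on the law of U. Under
   regularity both series converge almost surely, so that the value limn takes
   at a divergent series does not matter. *)
Definition adam_vector_field (X : {mfun (S * 'rV[R]_d)%type >-> 'rV[R]_d})
    (U : {RV P >-> S}) (alpha beta epsilon : R)
    (f : 'rV[R]_d -> 'rV[R]_d) : Prop :=
  exists (dQ : measure_display) (Xi : measurableType dQ)
    (Q : probability Xi R) (V : nat -> {RV Q >-> S}),
    iid_copies U V /\
    forall (theta : 'rV[R]_d) (j : 'I_d),
      f theta ord0 j = (1 - alpha) * fine 'E_Q[(fun w =>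
        (Num.sqrt ((1 - beta) * limn (series (fun k =>
             beta ^+ k * `|X (V k w, theta) ord0 j| ^+ 2))) + epsilon)^-1
        * limn (series (fun k => alpha ^+ k * X (V k w, theta) ord0 j)))%R].

End adam.

(* Main.v *)
Require Import Defs.
From HB Require Import structures.
From mathcomp Require Import all_boot all_order all_algebra finmap.
From mathcomp Require Import all_classical all_reals all_analysis.
From mathcomp Require Import measurable_realfun.
From mathcomp Require Import ring lra zify.

Set Implicit Arguments.
Unset Strict Implicit.
Unset Printing Implicit Defensive.

Import Order.TTheory GRing.Theory Num.Theory.
Import numFieldNormedType.Exports.

Local Open Scope classical_set_scope.
Local Open Scope ring_scope.

(** Why the vector field vanishes at a limit of the Adam algorithm.

Write [h_l(x)] for the normalized direction built from the innovations
[x 0, x 1, ..., x (l - 1)], listed from the most recent one: the exponential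
average of the [x i] with weights [alpha ^+ i], divided by [epsilon] plus the
square root of the exponential average of their squares with weights
[beta ^+ i]. Since [alpha ^+ 2 < beta], the Cauchy-Schwarz inequality bounds the
numerator by a multiple of that square root. Hence [h_l] is bounded, uniformly in
[l], and it is Lipschitz for the weighted square norm ([direction_bound],
[direction_lipschitz]); an innovation that is [l] steps old only matters up to
[beta ^+ l] ([direction_truncation]). In particular one step of the algorithm has
length at most a constant times the step size.

Consider a window of times [n, ..., k - 1] in which the step sizes add up to
about a small number [eta], and look at the event that [theta n] lies in a fixed
ball. The process moves by [O(eta)] during the window. Up to a mean error that is
small compared with [eta], its displacement is therefore the sum of
[gamma t.+1 * h_l(...)], where the last [l] innovations are evaluated at the
frozen parameter [theta n]: regularity in mean square bounds the effect of
freezing, and the exponentially weighted second moments of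
[weighted_energy_bounded] bound the effect of forgetting what is older. The
frozen directions have mean close to [f (theta n)] ([frozen_mean_dist]), and each
of them is independent of what was known [l] steps earlier, so that the second
moment of the sum of their deviations from [f (theta n)], weighted by the step
sizes, is small compared with [eta ^+ 2]. Hence the difference of
[theta k - theta n] and [f (theta n)] times the sum of the step sizes is small
compared with [eta] in mean ([window_bound], [window_dist]).

On the given event, [theta n] and [theta k] both tend to [theta_oo] in
probability, while [eta] stays fixed. So [eta * |f theta_oo|] is at most an
arbitrarily small multiple of [eta], except on an event of arbitrarily small
probability, and [f theta_oo] vanishes almost surely ([adam_limit_null]). *)

(** * Weighted sums and the normalized direction *)

(** Weighted Cauchy-Schwarz inequality. *)
Lemma sqr_sum_le_weighted (R : realFieldType) (I : finType) (w f g : I -> R) :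
  (forall i, 0 <= w i) ->
  (\sum_i w i * f i * g i) ^+ 2 <=
  (\sum_i w i * f i ^+ 2) * (\sum_i w i * g i ^+ 2).
Proof.
move=> w0.
have : 0 <= \sum_i \sum_j w i * w j * (f i * g j - f j * g i) ^+ 2.
  by do 2 (apply: sumr_ge0 => ? _); rewrite mulr_ge0 ?sqr_ge0// mulr_ge0.
have -> : \sum_i \sum_j w i * w j * (f i * g j - f j * g i) ^+ 2 =
    (\sum_i w i * f i ^+ 2) * (\sum_i w i * g i ^+ 2)
    + (\sum_i w i * g i ^+ 2) * (\sum_i w i * f i ^+ 2)
    - (\sum_i w i * f i * g i) * (\sum_i w i * f i * g i)
    - (\sum_i w i * f i * g i) * (\sum_i w i * f i * g i).
  rewrite !big_distrlr/= -big_split -!sumrB/=; apply: eq_bigr => i _.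
  by rewrite -big_split -!sumrB/=; apply: eq_bigr => j _; ring.
rewrite expr2; lra.
Qed.

(** Minkowski's inequality for the weighted square norm. *)
Lemma sqrt_sum_weighted_le (R : rcfType) (I : finType) (w f g : I -> R) :
  (forall i, 0 <= w i) ->
  Num.sqrt (\sum_i w i * (f i + g i) ^+ 2) <=
  Num.sqrt (\sum_i w i * f i ^+ 2) + Num.sqrt (\sum_i w i * g i ^+ 2).
Proof.
move=> w0.
have s0 (h : I -> R) : 0 <= \sum_i w i * h i ^+ 2.
  by apply: sumr_ge0 => i _; rewrite mulr_ge0 ?sqr_ge0.
rewrite -(ler_pXn2r (n := 2)) ?nnegrE ?addr_ge0 ?sqrtr_ge0// sqrrD !sqr_sqrtr//.
have -> : \sum_i w i * (f i + g i) ^+ 2 = \sum_i w i * f i ^+ 2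
    + (\sum_i w i * f i * g i) *+ 2 + \sum_i w i * g i ^+ 2.
  by rewrite -sumrMnl -!big_split/=; apply: eq_bigr => i _; ring.
rewrite lerD2r lerD2l lerMn2r /= -sqrtrM//.
apply: le_trans (ler_norm _) _; rewrite -sqrtr_sqr ler_wsqrtr//.
exact: sqr_sum_le_weighted.
Qed.

Section direction.
Variables (R : rcfType) (a b e : R).

(** Exponential average of the first [n] terms of [x], the term [x 0] being the
most recent one. *)
Definition momentum (n : nat) (x : nat -> R) : R :=
  (1 - a) * \sum_(i < n) a ^+ i * x i.

(** Exponential average of the squares of the first [n] terms of [x]. *)
Definition energy (n : nat) (x : nat -> R) : R :=
  (1 - b) * \sum_(i < n) b ^+ i * x i ^+ 2.

(** The direction of a step without bias correction, for a past of length [n]. *)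
Definition direction (n : nat) (x : nat -> R) : R :=
  (Num.sqrt (energy n x) + e)^-1 * momentum n x.

(** Bound of the direction; the quotient is positive since [a ^+ 2 < b < 1]. *)
Definition dirbound : R := (1 - a) / Num.sqrt ((1 - b) * (1 - a ^+ 2 / b)).

(** Lipschitz constant of the direction for the norm given by [energy]. *)
Definition dirlip : R := 2 * dirbound / e.

Hypotheses (e0 : 0 < e) (a01 : 0 <= a < 1) (b01 : a ^+ 2 < b < 1).

Let b0 : 0 < b. Proof. by case/andP: b01 => + _; apply: le_lt_trans; exact: sqr_ge0. Qed.
Let b1 : b < 1. Proof. by case/andP: b01. Qed.
Let ab1 : a ^+ 2 / b < 1. Proof. by rewrite ltr_pdivrMr// mul1r; case/andP: b01. Qed.
Let a1 : 0 < 1 - a. Proof. by rewrite subr_gt0; case/andP: a01. Qed.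

Lemma energy_ge0 n x : 0 <= energy n x.
Proof.
rewrite mulr_ge0 ?subr_ge0 ?(ltW b1)//; apply: sumr_ge0 => i _.
by rewrite mulr_ge0 ?sqr_ge0 ?exprn_ge0// ltW.
Qed.

Lemma dirbound_gt0 : 0 < dirbound.
Proof. by rewrite divr_gt0// sqrtr_gt0 mulr_gt0 ?subr_gt0. Qed.

Lemma dirlip_gt0 : 0 < dirlip.
Proof. by rewrite divr_gt0// mulr_gt0// dirbound_gt0. Qed.

Lemma sum_geom_le (q : R) n : 0 <= q < 1 -> \sum_(i < n) q ^+ i <= (1 - q)^-1.
Proof.
move=> /andP[q0 q1]; rewrite -[leRHS]div1r ler_pdivlMr ?subr_gt0//.
have := subrX1 q n; have := exprn_ge0 n q0; set S := \sum_(i < n) _; lra.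
Qed.

(** This is where [a ^+ 2 < b] matters: it makes the geometric series of ratio
[a ^+ 2 / b] summable. *)
Lemma normr_momentum_le n x :
  `|momentum n x| <= dirbound * Num.sqrt (energy n x).
Proof.
have en0 := energy_ge0 n x.
have d0 : 0 < (1 - b) * (1 - a ^+ 2 / b) by rewrite mulr_gt0 ?subr_gt0.
have k0 : 0 <= dirbound * Num.sqrt (energy n x).
  by rewrite mulr_ge0 ?sqrtr_ge0// ltW// dirbound_gt0.
rewrite -(ler_pXn2r (n := 2)) ?nnegrE//.
rewrite real_normK ?num_real// !exprMn !exprVn !sqr_sqrtr ?(ltW d0)// -mulrA.
rewrite ler_pM2l ?exprn_gt0// /energy.
have -> : ((1 - b) * (1 - a ^+ 2 / b))^-1 * ((1 - b) * (\sum_(i < n) b ^+ i * x i ^+ 2))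
   = (1 - a ^+ 2 / b)^-1 * \sum_(i < n) b ^+ i * x i ^+ 2.
  rewrite invfM mulrACA mulVf ?mul1r//; first by rewrite gt_eqF ?subr_gt0.
(* Cauchy-Schwarz with the weights [b ^+ i], to make the energy appear. *)
have -> : \sum_(i < n) a ^+ i * x i = \sum_(i < n) b ^+ i * (a / b) ^+ i * x i.
  by apply: eq_bigr => i _; rewrite expr_div_n mulrCA divff ?mulr1 ?expf_neq0 ?gt_eqF.
apply: le_trans (sqr_sum_le_weighted (w := fun i : 'I_n => b ^+ i)
  (fun i : 'I_n => (a / b) ^+ i) x _) _ => [i|].
  by rewrite exprn_ge0// ltW.
rewrite ler_wpM2r//.
  by apply: sumr_ge0 => i _; rewrite mulr_ge0 ?sqr_ge0 ?exprn_ge0// ltW.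
apply: le_trans (sum_geom_le n (q := a ^+ 2 / b) _).
  apply: ler_sum => i _; rewrite exprAC -exprMn.
  by rewrite (_ : b * (a / b) ^+ 2 = a ^+ 2 / b)//; field; rewrite gt_eqF.
by rewrite divr_ge0 ?sqr_ge0 ?(ltW b0)//=.
Qed.

Lemma energy_sym n x y :
  energy n (fun i => x i - y i) = energy n (fun i => y i - x i).
Proof.
by congr (_ * _); apply: eq_bigr => i _; rewrite -sqrrN opprB.
Qed.

Lemma energy_sqrt_dist n x y :
  `|Num.sqrt (energy n x) - Num.sqrt (energy n y)|
  <= Num.sqrt (energy n (fun i => x i - y i)).
Proof.
have sub z t : Num.sqrt (energy n z) - Num.sqrt (energy n t)
    <= Num.sqrt (energy n (fun i => z i - t i)).
  rewrite lerBlDr !sqrtrM ?subr_ge0 ?(ltW b1)// -mulrDr ler_wpM2l ?sqrtr_ge0//.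
  have -> : \sum_(i < n) b ^+ i * z i ^+ 2
      = \sum_(i < n) b ^+ i * ((z i - t i) + t i) ^+ 2.
    by apply: eq_bigr => i _; rewrite subrK.
  apply: sqrt_sum_weighted_le => i; by rewrite exprn_ge0// ltW.
rewrite ler_norml sub andbT lerNl opprB.
by apply: le_trans (sub y x) _; rewrite energy_sym.
Qed.

Lemma norm_div_sqrt_le q m : 0 <= q -> `|m| <= dirbound * Num.sqrt q ->
  `|(Num.sqrt q + e)^-1 * m| <= dirbound.
Proof.
move=> q0 mq; have s0 : 0 < Num.sqrt q + e by rewrite ltr_wpDl ?sqrtr_ge0.
rewrite normrM normfV (gtr0_norm s0) mulrC ler_pdivrMr//.
by apply: le_trans mq _; rewrite ler_pM2l ?dirbound_gt0// lerDl ltW.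
Qed.

Lemma direction_bound n x : `|direction n x| <= dirbound.
Proof. by apply: norm_div_sqrt_le; [exact: energy_ge0|exact: normr_momentum_le]. Qed.

Lemma momentumB n x y :
  momentum n x - momentum n y = momentum n (fun i => x i - y i).
Proof.
rewrite -mulrBr -sumrB; congr (_ * _).
by apply: eq_bigr => i _; rewrite mulrBr.
Qed.

Lemma direction_lipschitz n x y :
  (direction n x - direction n y) ^+ 2
  <= dirlip ^+ 2 * energy n (fun i => x i - y i).
Proof.
set q := energy n (fun i => x i - y i).
have q0 : 0 <= q := energy_ge0 n _.
have l0 := ltW dirlip_gt0.
suff : `|direction n x - direction n y| <= dirlip * Num.sqrt q.
  have lq0 : 0 <= dirlip * Num.sqrt q by rewrite (mulr_ge0 l0)// sqrtr_ge0.
  rewrite -(ler_pXn2r (n := 2)) ?nnegrE//.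
  by rewrite exprMn sqr_sqrtr// real_normK ?num_real.
have pos z : 0 < Num.sqrt (energy n z) + e by rewrite ltr_wpDl ?sqrtr_ge0.
have -> : direction n x - direction n y =
    (Num.sqrt (energy n x) + e)^-1 * momentum n (fun i => x i - y i)
    - (Num.sqrt (energy n x) + e)^-1 *
      (Num.sqrt (energy n x) - Num.sqrt (energy n y)) * direction n y.
  rewrite -momentumB /direction; have := pos x; have := pos y.
  by move=> /lt0r_neq0 hy /lt0r_neq0 hx; field; apply/andP.
apply: le_trans (ler_normB _ _) _.
have ie z : `|(Num.sqrt (energy n z) + e)^-1| <= e^-1.
  by rewrite normfV gtr0_norm// lef_pV2 ?posrE// lerDr sqrtr_ge0.
rewrite (normrM _ (momentum n _)) (normrM _ (direction n y)).
rewrite (normrM _ (Num.sqrt _ - _)) /dirlip (_ : 2 * dirbound / e * Num.sqrt q =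
  e^-1 * (dirbound * Num.sqrt q) + e^-1 * Num.sqrt q * dirbound); last by ring.
apply: lerD; apply: ler_pM.
- by [].
- by [].
- exact: ie.
- exact: normr_momentum_le.
- by rewrite mulr_ge0.
- by [].
- by apply: ler_pM => //; exact: energy_sqrt_dist.
- exact: direction_bound.
Qed.

Lemma momentumS n x :
  momentum n.+1 x = a * momentum n (fun i => x i.+1) + (1 - a) * x 0%N.
Proof.
rewrite /momentum big_ord_recl expr0 mul1r mulrDr addrC [in RHS]mulrCA; congr (_ * _ + _).
by rewrite mulr_sumr; apply: eq_bigr => i _; rewrite lift0 exprS mulrA.
Qed.

Lemma energyS n x :
  energy n.+1 x = b * energy n (fun i => x i.+1) + (1 - b) * x 0%N ^+ 2.
Proof.
rewrite /energy big_ord_recl expr0 mul1r mulrDr addrC [in RHS]mulrCA; congr (_ * _ + _).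
by rewrite mulr_sumr; apply: eq_bigr => i _; rewrite lift0 exprS -mulrA.
Qed.

Lemma energyD l k x :
  energy (l + k) x = energy l x + b ^+ l * energy k (fun i => x (l + i)%N).
Proof.
rewrite /energy big_split_ord/= mulrDr [in RHS]mulrCA; congr (_ + _ * _).
by rewrite mulr_sumr; apply: eq_bigr => i _; rewrite exprD -mulrA.
Qed.

(** Comparison of a past [x] of length [l + k] with a past [y] of length [l]: the
terms of [x] that are older than [l] steps are weighted by [b ^+ l]. *)
Lemma direction_truncation l k x y :
  (direction (l + k) x - direction l y) ^+ 2 <=
  dirlip ^+ 2 * (energy l (fun i => x i - y i)
                 + b ^+ l * energy k (fun i => x (l + i)%N)).
Proof.
(* A past of length [l] is a past of length [l + k] whose older terms vanish. *)
pose z i := if (i < l)%N then y i else 0.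
have -> : direction l y = direction (l + k) z.
  rewrite /direction (_ : energy (l + k) z = energy l y); last first.
    rewrite energyD /energy [X in b ^+ l * (_ * X)]big1 ?mulr0 ?addr0.
      by congr (_ * _); apply: eq_bigr => i _; rewrite /z ltn_ord.
    by move=> i _; rewrite /z ltnNge leq_addr/= expr0n mulr0.
  congr (_ * _); rewrite /momentum big_split_ord/= [X in _ * (_ + X)]big1 ?addr0.
    by congr (_ * _); apply: eq_bigr => i _; rewrite /z ltn_ord.
  by move=> i _; rewrite /z ltnNge leq_addr/= mulr0.
apply: le_trans (direction_lipschitz _ _ _) _.
rewrite ler_wpM2l ?sqr_ge0// energyD /energy.
under eq_bigr do rewrite /z ltn_ord.
by under [X in _ + _ * (_ * X)]eq_bigr do rewrite /z ltnNge leq_addr/= subr0.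
Qed.

(** Effect of the bias correction on the direction, for [q = b ^+ n]. *)
Lemma bias_correction_le q v m : 0 <= q < 1 -> 0 <= v ->
  `|m| <= dirbound * Num.sqrt v ->
  `|(Num.sqrt (v / (1 - q)) + e)^-1 * m - (Num.sqrt v + e)^-1 * m|
    <= dirbound * q.
Proof.
move=> /andP[q0 q1] v0 mv.
have r0 : 0 < 1 - q by rewrite subr_gt0.
set s' := Num.sqrt (v / (1 - q)); set s := Num.sqrt v in mv *.
have s'0 : 0 <= s' by exact: sqrtr_ge0.
have s0 : 0 <= s by exact: sqrtr_ge0.
have ss' : s <= s'.
  rewrite ler_wsqrtr// ler_pdivlMr// ler_piMr//; lra.
have s's : s' * (1 - q) <= s.
  rewrite -(ler_pXn2r (n := 2)) ?nnegrE ?mulr_ge0 ?(ltW r0)// exprMn !sqr_sqrtr//; last first.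
    by rewrite divr_ge0// ltW.
  rewrite expr2 mulrA divfK ?gt_eqF// ler_piMr//; lra.
have se0 : 0 < s + e by rewrite ltr_wpDl.
have se'0 : 0 < s' + e by rewrite ltr_wpDl.
have -> : (s' + e)^-1 * m - (s + e)^-1 * m = ((s + e)^-1 * m) * ((s - s') / (s' + e)).
  by move/lt0r_neq0: se0 => ?; move/lt0r_neq0: se'0 => ?; field; apply/andP.
rewrite normrM; apply: ler_pM => //; first exact: norm_div_sqrt_le.
rewrite normrM normfV (gtr0_norm se'0) ler_pdivrMr// ler0_norm ?subr_le0// opprB.
rewrite mulrDr; have : 0 <= q * e by rewrite mulr_ge0 // ltW.
lra.
Qed.

End direction.

(** * Independent pairs of random variables *)

Lemma bounded_integrable (R : realType) d (T : measurableType d)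
    (mu : probability T R) (h : T -> R) (c : R) :
  measurable_fun setT h -> (forall x, `|h x| <= c) ->
  mu.-integrable setT (EFin \o h).
Proof.
move=> mh hc; apply: measurable_bounded_integrable => //.
  by rewrite (le_lt_trans (probability_le1 mu measurableT)) ?ltry.
by exists c; split; [exact: num_real|move=> M cM x _; exact: le_trans (ltW cM)].
Qed.

Section independence.
Context {R : realType} {dO : measure_display} {Omega : measurableType dO}
  (P : probability Omega R).

Lemma dynkin_indep (G : set (set Omega)) (B : set Omega) :
  setI_closed G -> G `<=` measurable -> measurable B ->
  (forall A, G A -> P (A `&` B) = (P A * P B)%E) ->
  forall A, <<s G >> A -> P (A `&` B) = (P A * P B)%E.
Proof.
move=> GI Gm mB GB A; rewrite -setI_closed_g_dynkin_g_sigma_algebra// => GA.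
pose H := [set C | measurable C /\ P (C `&` B) = (P C * P B)%E].
suff : H A by case.
apply: GA; split => [|C GC]; last by split; [exact: Gm|exact: GB].
split.
- by split => //; rewrite setTI probability_setT mul1e.
- move=> C [mC CB]; split; first exact: measurableC.
  rewrite setIC -setDE.
  rewrite measureD//; last by rewrite (le_lt_trans (probability_le1 P mB)) ?ltry.
  transitivity (P B - P (C `&` B))%E; first by rewrite setIC.
  rewrite CB probability_setC// muleBl ?mul1e//; first exact: fin_num_measure.
- move=> F tF HF; have mF k : measurable (F k) by case: (HF k).
  split; first exact: bigcup_measurable.
  rewrite setI_bigcupl !measure_bigcup//; last 2 first.
    by move=> k _; exact: measurableI.
    by apply: trivIset_setIr.
  have PBE : P B = (fine (P B))%:E by rewrite fineK// fin_num_measure.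
  rewrite muleC PBE -nneseriesZl; last by move=> *; exact: measure_ge0.
  apply: eq_eseriesr => k _; rewrite -PBE muleC; exact: (HF k).2.
Qed.

Lemma indep_g_sigma_algebra (G H : set (set Omega)) :
  setI_closed G -> setI_closed H -> G `<=` measurable -> H `<=` measurable ->
  (forall A B, G A -> H B -> P (A `&` B) = (P A * P B)%E) ->
  forall A B, <<s G >> A -> <<s H >> B -> P (A `&` B) = (P A * P B)%E.
Proof.
move=> GI HI Gm Hm GH A B GA HB.
have mA : measurable A.
  by apply: GA; split => //; exact: sigma_algebra_measurable.
rewrite setIC muleC; apply: (dynkin_indep HI) => // C HC.
rewrite setIC muleC; apply: (dynkin_indep GI) => //; first exact: Hm.
by move=> D GD; exact: GH.
Qed.

(** The next two lemmas state Fubini's theorem for a pair of independent variables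
[Y] and [Z]: the variable [Z] may be replaced by an independent copy. *)
Section joint_law.
Context {dT dT' : measure_display} {T : measurableType dT}
  {T' : measurableType dT'}.
Variables (Y : Omega -> T) (Z : Omega -> T').
Hypotheses (mY : measurable_fun setT Y) (mZ : measurable_fun setT Z).
Hypothesis YZ : forall A B, measurable A -> measurable B ->
  P (Y @^-1` A `&` Z @^-1` B) = (P (Y @^-1` A) * P (Z @^-1` B))%E.

Let RY : {RV P >-> T} := mfun_Sub (mem_set mY).
Let RZ : {RV P >-> T'} := mfun_Sub (mem_set mZ).
Let mYZ : measurable_fun setT (fun w => (Y w, Z w)).
Proof. exact: measurable_fun_pair. Qed.
Let RYZ : {RV P >-> (T * T')%type} := mfun_Sub (mem_set mYZ).

Let lawE A : measurable A ->
  distribution P RYZ A = (distribution P RY \x distribution P RZ)%E A.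
Proof.
move=> mA; symmetry; apply: product_measure_unique => //.
Qed.

Lemma ge0_integral_indep (g : (T * T')%type -> \bar R) : measurable_fun setT g ->
  (forall x, 0 <= g x)%E ->
  (\int[P]_w g (Y w, Z w) = \int[P]_w \int[P]_w' g (Y w, Z w'))%E.
Proof.
move=> mg g0; rewrite -(ge0_integral_distribution (P := P) RYZ mg g0).
rewrite (eq_measure_integral (distribution P RY \x distribution P RZ)%E); last first.
  by move=> A mA _; exact: lawE.
rewrite fubini_tonelli1// ge0_integral_distribution//.
- by apply: eq_integral => w _; rewrite /= /fubini_F ge0_integral_distribution//;
    exact: measurableT_comp.
- exact: measurable_fun_fubini_tonelli_F.
- by move=> y; exact: integral_ge0.
Qed.

Lemma bounded_integral_indep (g : (T * T')%type -> R) (c : R) :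
  measurable_fun setT g -> (forall x, `|g x| <= c) ->
  (\int[P]_w (g (Y w, Z w))%:E = \int[P]_w \int[P]_w' (g (Y w, Z w'))%:E)%E.
Proof.
move=> mg gc.
have mgE : measurable_fun setT (EFin \o g) by exact/measurable_EFinP.
transitivity (\int[P]_w ((EFin \o g) \o RYZ) w)%E; first by [].
rewrite -(integral_distribution (P := P) (X := RYZ) mgE); last first.
  by apply: (@bounded_integrable _ _ _ P (fun w => g (Y w, Z w)) c) => //;
    exact: measurableT_comp.
rewrite (eq_measure_integral (distribution P RY \x distribution P RZ)%E); last first.
  by move=> A mA _; exact: lawE.
have ig : (distribution P RY \x distribution P RZ)%E.-integrable setT (EFin \o g).
  exact: bounded_integrable mg gc.
rewrite -(integral12_prod_meas1 ig).
rewrite integral_distribution//.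
- apply: eq_integral => w _; rewrite /= /fubini_F integral_distribution//.
    exact: measurableT_comp.
  by apply: (@bounded_integrable _ _ _ P (fun w' => g (Y w, Z w')) c) => //;
    apply: (measurableT_comp mg); exact: measurable_fun_pair.
- exact: (measurable_fubini_F ig).
- have /integrableP[mF Foo] := integrable_fubini_F ig.
  apply/integrableP; split; first exact: measurableT_comp.
  move: Foo; rewrite (ge0_integral_distribution (P := P) RY)//.
  exact: measurableT_comp.
Qed.

End joint_law.
End independence.

(** * The sigma-algebras generated by the innovations *)

Section cylinders.
Context {R : realType} {dS : measure_display} {S : measurableType dS}
  {dO : measure_display} {Omega : measurableType dO}.

(** Sets determined by finitely many of the variables [V i] with [i] in [I];
they form a pi-system generating the sigma-algebra of [(V i)_(i in I)]. *)
Definition cylinders (V : nat -> Omega -> S) (I : set nat) : set (set Omega) :=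
  [set A | exists (n : nat) (B : nat -> set S),
     [/\ forall i, measurable (B i), forall i, ~ I i -> B i = setT &
         A = \bigcap_(i in `I_n) V i @^-1` B i]].

(* Cylinders of different lengths are padded with [setT]. *)
Let pad (n : nat) (B : nat -> set S) i : set S := if (i < n)%N then B i else setT.

Let bigcap_pad V n m (B : nat -> set S) : (n <= m)%N ->
  \bigcap_(i in `I_n) V i @^-1` B i =
  \bigcap_(i in `I_m) V i @^-1` (pad n B i) :> set Omega.
Proof.
move=> nm; apply/seteqP; split => w /= Bw i /= im.
  by rewrite /pad; case: ltnP => // ilt; exact: Bw.
by have := Bw i (leq_trans im nm); rewrite /= /pad im.
Qed.

Lemma cylinders_setI V I J A B : cylinders V I A -> cylinders V J B ->
  exists (n : nat) (C D : nat -> set S),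
  [/\ (forall i, measurable (C i)) /\ (forall i, measurable (D i)),
      (forall i, ~ I i -> C i = setT) /\ (forall i, ~ J i -> D i = setT),
      A = \bigcap_(i in `I_n) V i @^-1` C i,
      B = \bigcap_(i in `I_n) V i @^-1` D i &
      A `&` B = \bigcap_(i in `I_n) V i @^-1` (C i `&` D i)].
Proof.
move=> [n [C [mC IC ->]]] [m [D [mD ID ->]]].
exists (maxn n m), (pad n C), (pad m D); split.
- by split=> i; rewrite /pad; case: ifP.
- by split=> i Ii; rewrite /pad; case: ifP => // _; [exact: IC|exact: ID].
- by rewrite (bigcap_pad _ _ (leq_maxl n m)).
- by rewrite (bigcap_pad _ _ (leq_maxr n m)).
- rewrite (bigcap_pad _ _ (leq_maxl n m)) (bigcap_pad _ _ (leq_maxr n m)).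
  by rewrite -bigcapI.
Qed.

Lemma setI_closed_cylinders V I : setI_closed (cylinders V I).
Proof.
move=> A B cA cB; have [n [C [D [[mC mD] [IC ID] _ _ ->]]]] := cylinders_setI cA cB.
exists n, (fun i => C i `&` D i); split => // i; first exact: measurableI.
by move=> Ii; rewrite IC// ID// setTI.
Qed.

Lemma sub_cylinders V I J : I `<=` J -> cylinders V I `<=` cylinders V J.
Proof.
by move=> IJ A [n [B [mB IB ->]]]; exists n, B; split => // i Ji;
  apply: IB; apply: contra_not Ji; exact: IJ.
Qed.

Lemma preimage_cylinders V (I : set nat) i (B : set S) : I i -> measurable B ->
  cylinders V I (V i @^-1` B).
Proof.
move=> Ii mB; exists i.+1, (fun k => if k == i then B else setT); split.
- by move=> k; case: ifP.
- by move=> k; case: eqP => // -> /(_ Ii).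
- apply/seteqP; split=> [w Bw k /= _|w /(_ i)/=]; first by case: eqP => //= ->.
  by rewrite eqxx; apply; exact: ltnSn.
Qed.

Section measurable_cylinders.
Variable V : nat -> Omega -> S.
Hypothesis mV : forall i, measurable_fun setT (V i).

Lemma measurable_cylinders I : cylinders V I `<=` measurable.
Proof.
move=> A [n [B [mB _ ->]]]; apply: bigcap_measurableType => // i _.
by rewrite -[X in measurable X]setTI; exact: mV.
Qed.

Lemma measurable_cylinders_var (I : set nat) i : I i ->
  measurable_fun setT (V i : g_sigma_algebraType (cylinders V I) -> S).
Proof.
move=> Ii _ B mB; rewrite setTI; apply: sub_sigma_algebra.
exact: preimage_cylinders.
Qed.

Context {dT : measure_display} {T : measurableType dT}.

Lemma measurable_cylindersS (I J : set nat) (Y : Omega -> T) : I `<=` J ->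
  measurable_fun setT (Y : g_sigma_algebraType (cylinders V I) -> T) ->
  measurable_fun setT (Y : g_sigma_algebraType (cylinders V J) -> T).
Proof.
move=> IJ mY _ B mB; have := mY measurableT B mB.
by apply: sub_sigma_algebra2; exact: sub_cylinders.
Qed.

Lemma measurable_cylindersT I (Y : Omega -> T) :
  measurable_fun setT (Y : g_sigma_algebraType (cylinders V I) -> T) ->
  measurable_fun setT Y.
Proof.
move=> mY _ B mB; have := mY measurableT B mB; apply.
by split; [exact: sigma_algebra_measurable|exact: measurable_cylinders].
Qed.

End measurable_cylinders.

Variables (P : probability Omega R) (V : nat -> {RV P >-> S}).
Hypothesis indV : mutually_independent V.

Lemma probability_cylinder n (B : nat -> set S) : (forall i, measurable (B i)) ->
  P (\bigcap_(i in `I_n) V i @^-1` B i) = (\prod_(i < n) P (V i @^-1` B i))%E.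
Proof.
move=> mB; pose J := [fset i in iota 0 n]%fset.
have -> : \bigcap_(i in `I_n) V i @^-1` B i = \bigcap_(i in [set` J]) V i @^-1` B i.
  congr bigcap; apply/seteqP; split => i /=;
    by rewrite /J !inE mem_iota.
rewrite indV; last by [].
rewrite -(big_mkord xpredT (fun i => P (V i @^-1` B i))) /index_iota subn0.
apply: perm_big; apply: uniq_perm; [exact: fset_uniq|exact: iota_uniq|].
by move=> i; rewrite !inE.
Qed.

Lemma probability_cylindersI (I J : set nat) A B : I `&` J = set0 ->
  cylinders V I A -> cylinders V J B -> P (A `&` B) = (P A * P B)%E.
Proof.
move=> IJ cA cB.
have [n [C [D [[mC mD] [IC ID] -> -> ->]]]] := cylinders_setI cA cB.
rewrite !probability_cylinder// => [|i]; last exact: measurableI.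
rewrite -big_split/=; apply: eq_bigr => i _.
have [Ii|nIi] := pselect (I i).
  have nJi : ~ J i by move=> Ji; have : (I `&` J) i by []; rewrite IJ.
  by rewrite ID// setIT preimage_setT probability_setT mule1.
by rewrite IC// setTI preimage_setT probability_setT mul1e.
Qed.

(** Independence of variables that are measurable for disjoint sets of indices. *)
Lemma indep_cylinders (I J : set nat) dT dT' (T : measurableType dT)
    (T' : measurableType dT') (Y : Omega -> T) (Z : Omega -> T') :
  I `&` J = set0 ->
  measurable_fun setT (Y : g_sigma_algebraType (cylinders V I) -> T) ->
  measurable_fun setT (Z : g_sigma_algebraType (cylinders V J) -> T') ->
  forall A B, measurable A -> measurable B ->
  P (Y @^-1` A `&` Z @^-1` B) = (P (Y @^-1` A) * P (Z @^-1` B))%E.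
Proof.
move=> IJ mY mZ A B mA mB.
have mV i : measurable_fun setT (V i) by [].
apply: (indep_g_sigma_algebra (@setI_closed_cylinders V I) (@setI_closed_cylinders V J)).
- exact: measurable_cylinders.
- exact: measurable_cylinders.
- by move=> C D; exact: probability_cylindersI.
- by have := mY measurableT A mA; rewrite setTI.
- by have := mZ measurableT B mB; rewrite setTI.
Qed.

End cylinders.

(** * Blocks of independent copies *)

Section tuple_law.
Context {R : realType} {dS : measure_display} {S : measurableType dS}.

(** Products of sets, which generate the sigma-algebra of [l.-tuple S]. *)
Definition box l (B : 'I_l -> set S) : set (l.-tuple S) :=
  [set z | forall i, B i (tnth z i)].

Lemma measurable_box l (B : 'I_l -> set S) : (forall i, measurable (B i)) ->
  measurable (box B).
Proof.
move=> mB; rewrite (_ : box B = \bigcap_(i in [set: 'I_l]) (@tnth _ S ^~ i) @^-1` B i); last first.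
  by apply/seteqP; split => z zB i => [_|]; exact: zB.
apply: fin_bigcap_measurable => // i _.
by rewrite -[X in measurable X]setTI; exact: measurable_tnth.
Qed.

Let boxes l : set (set (l.-tuple S)) :=
  [set A | exists B : 'I_l -> set S, (forall i, measurable (B i)) /\ A = box B].

Let measurable_boxes l : @measurable _ (l.-tuple S) = <<s @boxes l >>.
Proof.
apply/seteqP; split.
  apply: smallest_sub; first exact: smallest_sigma_algebra.
  rewrite -bigcup_seq; apply: bigcup_sub => i _ _ [B mB <-]; rewrite setTI.
  apply: sub_sigma_algebra; exists (fun k => if k == i then B else setT); split.
    by move=> k; case: ifP.
  apply/seteqP; split=> [z Bz k /=|z /(_ i)/=]; first by case: eqP => //= ->.
  by rewrite eqxx.
apply: smallest_sub; first exact: sigma_algebra_measurable.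
by move=> _ [B [mB ->]]; exact: measurable_box.
Qed.

Lemma tuple_measure_unique l (m1 m2 : probability (l.-tuple S) R) :
  (forall B : 'I_l -> set S, (forall i, measurable (B i)) ->
    m1 (box B) = m2 (box B)) ->
  forall A, measurable A -> m1 A = m2 A.
Proof.
move=> m12; apply: (measure_unique (@boxes l) (fun=> setT)) => //.
- exact: measurable_boxes.
- move=> _ _ [B [mB ->]] [C [mC ->]]; exists (fun i => B i `&` C i); split.
    by move=> i; exact: measurableI.
  by apply/seteqP; split=> [z [Bz Cz] i|z BCz]; [|split=> i; case: (BCz i)].
- by move=> _; exists (fun=> setT); split=> //; apply/seteqP; split.
- by rewrite bigcup_const//; exists 0%N.
- by move=> _ [B [mB ->]]; exact: m12.
- by move=> k; rewrite (le_lt_trans (probability_le1 _ _)) ?ltry.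
Qed.

Context {dO : measure_display} {Omega : measurableType dO}
  (P : probability Omega R) {U : {RV P >-> S}}.

Section copies.
Context {dQ : measure_display} {Xi : measurableType dQ}
  (Q : probability Xi R) (V : nat -> {RV Q >-> S}).
Hypothesis iidV : iid_copies U V.

(** The variables of index [s 0, ..., s (l - 1)], as a tuple. *)
Definition block l (s : 'I_l -> nat) (w : Xi) : l.-tuple S :=
  [tuple V (s i) w | i < l].

Lemma measurable_block l (s : 'I_l -> nat) : measurable_fun setT (block s).
Proof.
apply/measurable_fun_tnthP => i.
rewrite (_ : _ \o _ = V (s i)); first by [].
by apply/funext => w; rewrite /= tnth_mktuple.
Qed.

Lemma probability_block l (s : 'I_l -> nat) (B : 'I_l -> set S) :
  injective s -> (forall i, measurable (B i)) ->
  Q (block s @^-1` box B) = (\prod_(i < l) distribution P U (B i))%E.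
Proof.
move=> sinj mB.
pose J := [fset s i | i in 'I_l]%fset.
pose C k := if [pick i | s i == k] is Some i then B i else setT.
have Cs i : C (s i) = B i.
  rewrite /C; case: pickP => [i' /eqP/sinj->//|/(_ i)]; by rewrite eqxx.
have -> : block s @^-1` box B = \bigcap_(k in [set` J]) V k @^-1` C k.
  apply/seteqP; split => w /=.
    move=> Bw _ /imfsetP[i _ ->] /=; rewrite Cs.
    by have := Bw i; rewrite tnth_mktuple.
  move=> Cw i; rewrite tnth_mktuple -Cs; apply: Cw.
  by apply/imfsetP; exists i.
rewrite iidV.1; last by move=> k _; rewrite /C; case: pickP.
rewrite (perm_big [seq s i | i <- enum 'I_l]); last first.
  apply: uniq_perm; [exact: fset_uniq|by rewrite map_inj_uniq ?enum_uniq|].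
  move=> k; apply/imfsetP/mapP => -[i _ ->]; exists i => //.
  by rewrite mem_enum.
rewrite big_map big_enum/=; apply: eq_bigr => i _.
by rewrite Cs; exact: (iidV.2 (s i) _ (mB i)).
Qed.

End copies.

Context {dQ dQ' : measure_display} {Xi : measurableType dQ}
  {Xi' : measurableType dQ'} (Q : probability Xi R) (Q' : probability Xi' R)
  (V : nat -> {RV Q >-> S}) (V' : nat -> {RV Q' >-> S}).
Hypotheses (iidV : iid_copies U V) (iidV' : iid_copies U V').

(** The law of a block of distinct copies depends neither on the copies nor on the
probability space. *)
Lemma bounded_integral_block l (s s' : 'I_l -> nat) (g : l.-tuple S -> R) c :
  injective s -> injective s' -> measurable_fun setT g ->
  (forall z, `|g z| <= c) ->
  (\int[Q]_w (g (block V s w))%:E = \int[Q']_w (g (block V' s' w))%:E)%E.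
Proof.
move=> si s'i mg gc.
pose Z : {RV Q >-> l.-tuple S} := mfun_Sub (mem_set (measurable_block V s)).
pose Z' : {RV Q' >-> l.-tuple S} := mfun_Sub (mem_set (measurable_block V' s')).
have mgE : measurable_fun setT (EFin \o g) by exact/measurable_EFinP.
transitivity (\int[Q]_w ((EFin \o g) \o Z) w)%E; first by [].
rewrite -(integral_distribution (P := Q) (X := Z) mgE); last first.
  apply: (@bounded_integrable _ _ _ Q (fun w => g (block V s w)) c) => //.
  by apply: (measurableT_comp mg); exact: measurable_block.
transitivity (\int[Q']_w ((EFin \o g) \o Z') w)%E; last by [].
rewrite -(integral_distribution (P := Q') (X := Z') mgE); last first.
  apply: (@bounded_integrable _ _ _ Q' (fun w => g (block V' s' w)) c) => //.
  by apply: (measurableT_comp mg); exact: measurable_block.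
apply: eq_measure_integral => A mA _.
apply: (tuple_measure_unique (m1 := distribution Q Z) (m2 := distribution Q' Z')) => // B mB.
transitivity (\prod_(i < l) distribution P U (B i))%E.
  exact: (probability_block iidV si mB).
symmetry; exact: (probability_block iidV' s'i mB).
Qed.

Lemma ge0_integral_copy (g : S -> \bar R) k : measurable_fun setT g ->
  (forall x, 0 <= g x)%E ->
  (\int[Q]_w g (V k w) = \int[P]_w g (U w))%E.
Proof.
move=> mg g0.
rewrite -(ge0_integral_distribution (P := Q) (V k) mg g0).
rewrite -(ge0_integral_distribution (P := P) U mg g0).
by apply: eq_measure_integral => A mA _; exact: iidV.2.
Qed.

End tuple_law.

(** * Euclidean norm, measurability and moments of the innovation *)

Section enorm.
Context {R : realType} {d : nat}.
Implicit Types x y : 'rV[R]_d.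

Lemma enorm_ge0 x : 0 <= enorm x. Proof. exact: sqrtr_ge0. Qed.

Lemma sqr_enorm x : enorm x ^+ 2 = \sum_(j < d) x ord0 j ^+ 2.
Proof. by rewrite sqr_sqrtr// sumr_ge0// => j _; exact: sqr_ge0. Qed.

Lemma enormN x : enorm (- x) = enorm x.
Proof. by congr Num.sqrt; apply: eq_bigr => j _; rewrite mxE sqrrN. Qed.

Lemma enormD x y : enorm (x + y) <= enorm x + enorm y.
Proof.
have E (h : 'I_d -> R) : \sum_j h j ^+ 2 = \sum_j 1 * h j ^+ 2.
  by apply: eq_bigr => j _; rewrite mul1r.
apply: le_trans (_ : Num.sqrt (\sum_j 1 * (x ord0 j + y ord0 j) ^+ 2) <= _).
  by rewrite -E ler_wsqrtr//; apply: ler_sum => j _; rewrite mxE.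
rewrite /enorm (E (x ord0)) (E (y ord0)).
exact: (sqrt_sum_weighted_le (w := fun=> 1)).
Qed.

Lemma enormBC x y : enorm (x - y) = enorm (y - x).
Proof. by rewrite -enormN opprB. Qed.

Lemma enorm_le_dist x y : enorm x <= enorm y + enorm (x - y).
Proof. by apply: le_trans (enormD _ _); rewrite addrC subrK. Qed.

Lemma normr_coord_le x j : `|x ord0 j| <= enorm x.
Proof.
rewrite -sqrtr_sqr ler_wsqrtr// (bigD1 j)//= lerDl.
by apply: sumr_ge0 => i _; exact: sqr_ge0.
Qed.

Lemma enorm_le_coord x c : 0 <= c -> (forall j, `|x ord0 j| <= c) ->
  enorm x <= d%:R * c.
Proof.
move=> c0 xc; rewrite -(ler_pXn2r (n := 2)) ?nnegrE ?enorm_ge0 ?mulr_ge0//.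
rewrite sqr_enorm; apply: (@le_trans _ _ (\sum_(j < d) c ^+ 2)).
  apply: ler_sum => j _.
  by rewrite -[leLHS]real_normK ?num_real// ler_pXn2r// nnegrE.
rewrite sumr_const card_ord -[leLHS]mulr_natl exprMn ler_wpM2r ?sqr_ge0//.
by rewrite -natrX ler_nat; case: (d) => // n; rewrite expnS expn1 leq_pmulr.
Qed.

Lemma enorm_eq0 x : enorm x = 0 -> x = 0.
Proof.
move=> x0; apply/rowP => j; rewrite mxE; apply/eqP.
by rewrite -normr_le0 -x0; exact: normr_coord_le.
Qed.

End enorm.

Section measurability.
Context {R : realType} {d0 : measure_display} {T : measurableType d0}.

Lemma measurable_fun_sqrt (f : T -> R) : measurable_fun setT f ->
  measurable_fun setT (fun x => Num.sqrt (f x)).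
Proof.
by move=> mf; apply: (@measurableT_comp _ _ _ _ _ _ (@Num.sqrt R)) => //;
  apply: continuous_measurable_fun; exact: sqrt_continuous.
Qed.

Lemma measurable_fun_invr_pos (f : T -> R) : (forall x, 0 < f x) ->
  measurable_fun setT f -> measurable_fun setT (fun x => (f x)^-1).
Proof.
move=> f0 mf; rewrite (_ : (fun x => _) = fun x => f x `^ (-1)); last first.
  by apply/funext => x; rewrite powR_inv1// ltW.
exact: (measurableT_comp (measurable_powR _)).
Qed.

Lemma measurable_fun_rV d (f : T -> 'rV[R]_d) :
  (forall j, measurable_fun setT (fun x => f x ord0 j)) <-> measurable_fun setT f.
Proof.
split=> [mf|mf j]; last exact: (measurableT_comp (@measurable_rV_coord R d j)).
move=> _ B mB; rewrite setTI.
pose H : set (set 'rV[R]_d) := [set C | measurable (f @^-1` C)].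
suff : measurable `<=` H by exact.
apply: smallest_sub.
  split => /=; rewrite /H/=.
  - by rewrite preimage_set0; exact: measurable0.
  - by move=> C mC; rewrite setTD preimage_setC; exact: measurableC.
  - by move=> F mF; rewrite preimage_bigcup; exact: bigcupT_measurable.
rewrite -bigcup_seq; apply: bigcup_sub => j _ _ [C mC <-]; rewrite setTI /H/=.
by rewrite -[X in measurable X]setTI; exact: mf.
Qed.

Lemma measurable_fun_enorm d (f : T -> 'rV[R]_d) :
  measurable_fun setT f -> measurable_fun setT (fun x => enorm (f x)).
Proof.
move=> mf; apply: measurable_fun_sqrt; apply: measurable_sum => j.
by apply: measurable_funX; apply/measurable_fun_rV: j.
Qed.

End measurability.

Lemma integral_cst_probability {R : realType} {d} {T : measurableType d}
  (P : probability T R) (c : R) : (\int[P]_w c%:E)%E = c%:E.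
Proof. by rewrite -[RHS](expectation_cst P) unlock. Qed.

Section real_integrals.
Context {R : realType} {d} {T : measurableType d} (P : probability T R).

Lemma ge0_integral_scale (k : R) (g : T -> R) : 0 <= k ->
  measurable_fun setT g -> (forall w, 0 <= g w) ->
  (\int[P]_w (k * g w)%:E = k%:E * \int[P]_w (g w)%:E)%E.
Proof.
move=> k0 mg g0; under eq_integral do rewrite EFinM.
rewrite ge0_integralZl//; first exact/measurable_EFinP.
by move=> w _; rewrite lee_fin.
Qed.

Lemma ge0_integral_add (g h : T -> R) :
  measurable_fun setT g -> measurable_fun setT h ->
  (forall w, 0 <= g w) -> (forall w, 0 <= h w) ->
  (\int[P]_w (g w + h w)%:E = \int[P]_w (g w)%:E + \int[P]_w (h w)%:E)%E.
Proof.
move=> mg mh g0 h0; under eq_integral do rewrite EFinD.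
rewrite ge0_integralD//; try exact/measurable_EFinP;
  by move=> w _; rewrite lee_fin.
Qed.

Lemma ge0_integral_mono (g h : T -> R) :
  measurable_fun setT g -> measurable_fun setT h ->
  (forall w, 0 <= g w) -> (forall w, g w <= h w) ->
  (\int[P]_w (g w)%:E <= \int[P]_w (h w)%:E)%E.
Proof.
move=> mg mh g0 gh; apply: ge0_le_integral => //; try exact/measurable_EFinP;
  by move=> w _; rewrite lee_fin.
Qed.

End real_integrals.

Section moments.
Context {R : realType} {dS : measure_display} {S : measurableType dS} {d : nat}
  {dO : measure_display} {Omega : measurableType dO} {P : probability Omega R}.
Variables (X : {mfun (S * 'rV[R]_d)%type >-> 'rV[R]_d}) (U : {RV P >-> S}).
Variables (p : R).
Hypotheses (hp : 2 <= p) (XU : locally_regular p X U).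

Lemma measurable_innovation {d0 : measure_display} {T : measurableType d0}
    (V : T -> S) (Y : T -> 'rV[R]_d) j :
  measurable_fun setT V -> measurable_fun setT Y ->
  measurable_fun setT (fun w => X (V w, Y w) ord0 j).
Proof.
move=> mV mY; apply/measurable_fun_rV: j.
by apply: (measurableT_comp (f := X)) => //; exact: measurable_fun_pair.
Qed.

(** Reduces the [p]-th moment to the second one without Jensen's inequality. *)
Lemma sqr_le_powR (x t : R) : `|x| <= t -> x ^+ 2 <= 1 + t `^ p.
Proof.
move=> xt; have t0 : 0 <= t by exact: le_trans xt.
have -> : x ^+ 2 = `|x| ^+ 2 by rewrite real_normK ?num_real.
apply: (@le_trans _ _ (t ^+ 2)); first by rewrite ler_pXn2r// nnegrE.
have [t1|/ltW t1] := leP t 1.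
  by rewrite (@le_trans _ _ 1)// ?expr_le1// lerDl powR_ge0.
rewrite -powR_mulrn// (@le_trans _ _ (t `^ p))// ?ler_powR//; last by rewrite lerDr.
Qed.

(** The second moment of the innovation grows at most exponentially. *)
Lemma second_moment : exists c lam : R, [/\ 0 <= c, 0 <= lam &
  forall theta j, (\int[P]_w ((X (U w, theta) ord0 j) ^+ 2)%:E <=
    (c * expR (lam * enorm theta))%:E)%E].
Proof.
have [c [_ XUc]] := XU.
have c0 : 0 <= c 0.
  have [+ _] := XUc 0 0; move=> /(le_trans (expectation_ge0 _ _)) => /(_ (fun=> powR_ge0 _ _)).
  by rewrite lee_fin pmulr_lge0// ltr_wpDl// expR_gt0.
exists (1 + 2 * c 0), (c 0); split => //; first by rewrite addr_ge0// mulr_ge0.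
move=> theta j.
have mE : measurable_fun setT (fun w => enorm (X (U w, theta)) `^ p).
  apply: (measurableT_comp (measurable_powR p)); apply: measurable_fun_enorm.
  by apply/measurable_fun_rV => k; exact: measurable_innovation.
apply: (@le_trans _ _ (\int[P]_w (1%:E + (enorm (X (U w, theta)) `^ p)%:E))%E).
  apply: ge0_le_integral => //.
  - by move=> w _; rewrite lee_fin sqr_ge0.
  - by apply/measurable_EFinP/measurable_funX; exact: measurable_innovation.
  - by apply/measurable_EFinP; exact: measurable_funD.
  - by move=> w _; rewrite -EFinD lee_fin sqr_le_powR// normr_coord_le.
rewrite ge0_integralD//; last 2 first.
  - by move=> w _; rewrite lee_fin powR_ge0.
  - exact/measurable_EFinP.
rewrite integral_cst_probability.
have [+ _] := XUc theta 0; rewrite unlock => Xp.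
apply: (le_trans (leeD2l _ Xp)); rewrite -EFinD lee_fin.
have : 1 <= expR (c 0 * enorm theta) by rewrite -expR0 ler_expR mulr_ge0// enorm_ge0.
set E := expR _ => E1; nra.
Qed.

(** The innovation is Lipschitz in mean square on balls. *)
Lemma local_lipschitz (r : R) : 0 <= r -> exists2 K : R, 0 <= K &
  forall theta theta', enorm theta <= r -> enorm theta' <= r -> forall j,
   (\int[P]_w ((X (U w, theta) ord0 j - X (U w, theta') ord0 j) ^+ 2)%:E <=
    (K * enorm (theta - theta') ^+ 2)%:E)%E.
Proof.
move=> r0; have [c [cc XUc]] := XU.
have [||m _ cm] := @EVT_max R c 0 (2 * r).
- by rewrite mulr_ge0.
- exact: continuous_subspaceT.
exists (1 + `|c m|); first by rewrite addr_ge0.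
move=> y y' yr y'r j; set t := enorm (y - y').
have t0 : 0 <= t by exact: enorm_ge0.
have [t00|tn0] := eqVneq t 0.
  have /eqP := enorm_eq0 t00; rewrite subr_eq0 => /eqP ->.
  under eq_integral do rewrite subrr expr0n/=.
  by rewrite integral_cst_probability lee_fin mulr_ge0// ?addr_ge0// sqr_ge0.
have {t0 tn0}t0 : 0 < t by rewrite lt_neqAle eq_sym tn0.
set Z := fun w => enorm (X (U w, y) - X (U w, y')) `^ p.
have mZ : measurable_fun setT Z.
  apply: (measurableT_comp (measurable_powR p)); apply: measurable_fun_enorm.
  apply/measurable_fun_rV => k.
  rewrite (_ : (fun x => _) = fun w => X (U w, y) ord0 k - X (U w, y') ord0 k).
    by apply: measurable_funB; exact: measurable_innovation.
  by apply/funext => w; rewrite !mxE.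
have Z0 w : 0 <= Z w by exact: powR_ge0.
(* [sqr_le_powR] after division by [t], which makes the bound homogeneous. *)
apply: (@le_trans _ _ (\int[P]_w ((t ^+ 2)%:E + (t ^+ 2 * t^-1 `^ p)%:E * (Z w)%:E))%E).
  apply: ge0_le_integral => //.
  - by move=> w _; rewrite lee_fin sqr_ge0.
  - apply/measurable_EFinP/measurable_funX; apply: measurable_funB;
      exact: measurable_innovation.
  - under eq_fun do rewrite -EFinM -EFinD.
    apply/measurable_EFinP; apply: measurable_funD => //; exact: measurable_funM.
  - move=> w _; rewrite -EFinM -EFinD lee_fin.
    set x := X (U w, y) ord0 j - _.
    have := @sqr_le_powR (x / t) (t^-1 * enorm (X (U w, y) - X (U w, y'))).
    rewrite normrM normfV (gtr0_norm t0) mulrC ler_pM2l ?invr_gt0//.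
    have -> : `|x| <= enorm (X (U w, y) - X (U w, y')).
      by have := normr_coord_le (X (U w, y) - X (U w, y')) j; rewrite !mxE.
    move=> /(_ isT); rewrite powRM ?invr_ge0 ?enorm_ge0 ?(ltW t0)// -/(Z w).
    rewrite exprMn exprVn ler_pdivrMr ?exprn_gt0//.
    by rewrite mulrC mulrDr mulr1 mulrA.
rewrite ge0_integralD//; last 3 first.
  - by move=> w _; rewrite lee_fin sqr_ge0.
  - by move=> w _; rewrite -EFinM lee_fin mulr_ge0 ?Z0 ?(mulr_ge0 (sqr_ge0 _) (powR_ge0 _ _)).
  - under eq_fun do rewrite -EFinM; apply/measurable_EFinP; exact: measurable_funM.
rewrite ge0_integralZl//; last 3 first.
  - exact/measurable_EFinP.
  - by move=> w _; rewrite lee_fin Z0.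
  - by rewrite lee_fin mulr_ge0 ?sqr_ge0 ?powR_ge0.
rewrite integral_cst_probability.
have [_ +] := XUc y y'; rewrite unlock -/Z -/t => Zp.
have {}Zp : (\int[P]_w (Z w)%:E <= (`|c m| * t `^ p)%:E)%E.
  apply: le_trans Zp _; rewrite lee_fin ler_wpM2r ?powR_ge0//.
  apply: le_trans (ler_norm _); apply: cm.
  rewrite in_itv/= addr_ge0 ?enorm_ge0//=; lra.
have tp : t^-1 `^ p * t `^ p = 1.
  by rewrite -powRM ?invr_ge0 ?(ltW t0)// mulVf ?powR1 ?gt_eqF.
apply: (@le_trans _ _ ((t ^+ 2)%:E + (t ^+ 2 * t^-1 `^ p)%:E * (`|c m| * t `^ p)%:E)%E).
  by rewrite leeD2l// lee_wpmul2l// lee_fin mulr_ge0 ?sqr_ge0 ?powR_ge0.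
rewrite -EFinM -EFinD lee_fin.
rewrite (_ : t ^+ 2 * _ * _ = t ^+ 2 * `|c m| * (t^-1 `^ p * t `^ p)); last by ring.
by rewrite tp; lra.
Qed.

End moments.

(** * Limits of measurable functions, mean squares *)

Section measurable_lim.
Context {R : realType} {d : measure_display} {T : measurableType d}.
Variable u : nat -> T -> R.
Hypothesis mu : forall n, measurable_fun setT (u n).

Let lo w := limn_einf (fun n => (u n w)%:E).
Let hi w := limn_esup (fun n => (u n w)%:E).

Let mhi : measurable_fun setT hi.
Proof. by apply: measurable_fun_limn_esup => n; exact/measurable_EFinP. Qed.

Let mlo : measurable_fun setT lo.
Proof.
rewrite /lo /limn_einf; apply: (measurableT_comp (f := -%E)) => //.
apply: measurable_fun_limn_esup => n.
by apply: (measurableT_comp (f := -%E)) => //; exact/measurable_EFinP.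
Qed.

Let cvgE w : cvgn (u ^~ w) <-> lo w = hi w /\ hi w \is a fin_num.
Proof.
split=> [cu|[lohi hifin]].
  have ce : (fun n => (u n w)%:E) @ \oo --> (limn (u ^~ w))%:E.
    by apply/fine_cvgP; split; [exact: nearW|exact: cu].
  by rewrite /lo /hi; have [-> ->] := cvg_limn_einf_sup ce.
suff : (fun n => (u n w)%:E) @ \oo --> hi w.
  by rewrite -(fineK hifin) => /fine_cvgP[_ cu]; apply/cvg_ex; exists (fine (hi w)).
apply: (@squeeze_cvge _ _ _ _ (einfs (fun n => (u n w)%:E)) _
  (esups (fun n => (u n w)%:E))).
- apply: nearW => n; apply/andP; split.
    by apply: ereal_inf_lbound; exists n => /=.
  by apply: ereal_sup_ubound; exists n => /=.
- rewrite -lohi /lo limn_einf_lim; exact: is_cvg_einfs.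
- rewrite /hi limn_esup_lim; exact: is_cvg_esups.
Qed.

(** No convergence is assumed: where [u ^~ w] diverges, [limn] takes the default
value [point], and the set of convergence is measurable. *)
Lemma measurable_fun_limn : measurable_fun setT (fun w => limn (u ^~ w)).
Proof.
pose D := [set w | cvgn (u ^~ w)].
have mD : measurable D.
  have -> : D = [set w | lo w = hi w] `&` [set w | hi w \is a fin_num].
    by apply/seteqP; split => w; rewrite /D/= cvgE.
  apply: measurableI; last first.
    by have := emeasurable_fin_num measurableT mhi; rewrite setTI.
  have := measurable_eqe measurableT mlo mhi.
  by rewrite setTI.
apply: (@measurable_fun_cvg _ _ _ _ (fun n w => if w \in D then u n w else point)).
  move=> n; apply: measurable_fun_ifT => //.
  by apply: (measurable_fun_bool true); rewrite setTI (_ : _ @^-1` _ = D)//;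
    apply/seteqP; split=> w /= => [/set_mem|/mem_set].
move=> w _; have [Dw|nDw] := boolP (w \in D); first exact: (set_mem Dw).
by move: nDw; rewrite notin_setE => /dvgP ->; exact: cvg_cst.
Qed.

End measurable_lim.

Section expectation_bounds.
Context {R : realType} {d0 : measure_display} {T : measurableType d0}
  (P : probability T R).

(** Jensen's inequality for the square. *)
Lemma sqr_Rintegral_le (g : T -> R) (c s : R) : measurable_fun setT g ->
  (forall w, `|g w| <= c) -> (\int[P]_w (g w ^+ 2)%:E <= s%:E)%E ->
  (\int[P]_w g w) ^+ 2 <= s.
Proof.
have sq (x y : R) : 2 * y * x - y ^+ 2 <= x ^+ 2.
  by have := sqr_ge0 (x - y); rewrite sqrrB; lra.
move=> mg gc; set m := \int[P]_w g w => gs.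
have c0 (w : T) : 0 <= c by exact: le_trans (normr_ge0 _) (gc w).
have ig := bounded_integrable P mg gc.
have ig2 : P.-integrable setT (EFin \o (fun w => g w ^+ 2)).
  apply: (@bounded_integrable _ _ _ P _ (c ^+ 2)); first exact: measurable_funX.
  by move=> w; rewrite normrX ler_pXn2r// nnegrE// (c0 w).
have icst : P.-integrable setT (EFin \o cst (m ^+ 2)) by exact: finite_measure_integrable_cst.
have ilin : P.-integrable setT (EFin \o (fun w => 2 * m * g w)).
  by rewrite /comp; under eq_fun do rewrite EFinM; exact: integrableZl.
have : \int[P]_w (2 * m * g w - m ^+ 2) <= \int[P]_w (g w ^+ 2).
  apply: le_Rintegral => //.
    by rewrite /comp; under eq_fun do rewrite EFinB; exact: (integrableB _ ilin icst).
rewrite RintegralB// RintegralZl// -/m.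
have -> : \int[P]_w cst (m ^+ 2) w = m ^+ 2 by rewrite /Rintegral integral_cst_probability.
have : \int[P]_w (g w ^+ 2) <= s.
  rewrite -lee_fin /Rintegral fineK//; exact: integrable_fin_num.
clear c0; rewrite expr2; lra.
Qed.

Lemma bounded_integralE (g : T -> R) (c : R) : measurable_fun setT g ->
  (forall w, `|g w| <= c) -> (\int[P]_w (g w)%:E = (\int[P]_w g w)%:E)%E.
Proof.
move=> mg gc; rewrite /Rintegral fineK//.
exact: (integrable_fin_num measurableT (bounded_integrable P mg gc)).
Qed.

Lemma integral_norm_le_sqrt (g : T -> R) (c s : R) : measurable_fun setT g ->
  (forall w, `|g w| <= c) -> 0 <= s -> (\int[P]_w (g w ^+ 2)%:E <= (s ^+ 2)%:E)%E ->
  (\int[P]_w `|g w|%:E <= s%:E)%E.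
Proof.
move=> mg gc s0 gs.
have mng : measurable_fun setT (fun w => `|g w|) by exact: measurableT_comp.
have ngc w : `| `|g w| | <= c by rewrite normr_id.
rewrite (bounded_integralE mng ngc) lee_fin.
have : (\int[P]_w `|g w|) ^+ 2 <= s ^+ 2.
  apply: (sqr_Rintegral_le mng ngc).
  by under eq_integral do rewrite real_normK ?num_real//.
by rewrite ler_pXn2r// nnegrE; apply: Rintegral_ge0.
Qed.

Variables (a b e : R).
Hypotheses (b0 : 0 < b) (b1 : b < 1).

Lemma measurable_energy n (x : nat -> T -> R) :
  (forall i, measurable_fun setT (x i)) ->
  measurable_fun setT (fun w => energy b n (x ^~ w)).
Proof.
move=> mx; apply: measurable_funM => //; apply: measurable_sum => i.
by apply: measurable_funM => //; exact: measurable_funX.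
Qed.

Lemma measurable_momentum n (x : nat -> T -> R) :
  (forall i, measurable_fun setT (x i)) ->
  measurable_fun setT (fun w => momentum a n (x ^~ w)).
Proof.
move=> mx; apply: measurable_funM => //; apply: measurable_sum => i.
exact: measurable_funM.
Qed.

Lemma measurable_direction n (x : nat -> T -> R) : 0 < e ->
  (forall i, measurable_fun setT (x i)) ->
  measurable_fun setT (fun w => direction a b e n (x ^~ w)).
Proof.
move=> e0 mx; apply: measurable_funM; last exact: measurable_momentum.
apply: measurable_fun_invr_pos => [w|]; first by rewrite ltr_wpDl ?sqrtr_ge0.
apply: measurable_funD => //; apply: measurable_fun_sqrt; exact: measurable_energy.
Qed.

(** The weights of [energy] add up to at most [1]. *)
Lemma integral_energy_le n (x : nat -> T -> R) (c : R) : 0 <= c ->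
  (forall i, (i < n)%N -> measurable_fun setT (x i)) ->
  (forall i, (i < n)%N -> \int[P]_w (x i w ^+ 2)%:E <= c%:E)%E ->
  (\int[P]_w (energy b n (x ^~ w))%:E <= c%:E)%E.
Proof.
move=> c0 mx xc; rewrite /energy.
have mxn i : (i < n)%N -> measurable_fun setT (fun w => (x i w ^+ 2)%:E).
  by move=> im; apply/measurable_EFinP/measurable_funX; exact: mx.
under eq_integral do rewrite EFinM -sumEFin.
under eq_integral do under eq_bigr do rewrite EFinM.
rewrite ge0_integralZl//; last 3 first.
- apply: emeasurable_sum => i; apply: emeasurable_funM => //; exact: mxn.
- move=> w _; apply: sume_ge0 => i _; rewrite -EFinM lee_fin.
  by rewrite mulr_ge0 ?sqr_ge0 ?exprn_ge0// ltW.
- by rewrite lee_fin subr_ge0 ltW.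
rewrite ge0_integral_sum//; last 2 first.
- by move=> i; apply: emeasurable_funM => //; exact: mxn.
- by move=> i w _; rewrite -EFinM lee_fin mulr_ge0 ?sqr_ge0 ?exprn_ge0// ltW.
apply: (@le_trans _ _ ((1 - b)%:E * \sum_(i < n) (b ^+ i * c)%:E)%E).
  rewrite lee_wpmul2l ?lee_fin ?subr_ge0 ?(ltW b1)//; apply: lee_sum => i _.
  rewrite ge0_integralZl//; last 3 first.
  - exact: mxn.
  - by move=> w _; rewrite lee_fin sqr_ge0.
  - by rewrite lee_fin exprn_ge0// ltW.
  rewrite EFinM lee_wpmul2l ?lee_fin ?exprn_ge0 ?(ltW b0)//; exact: xc.
rewrite sumEFin -EFinM lee_fin -mulr_suml mulrA ler_piMl//.
have := sum_geom_le n (q := b); rewrite (ltW b0) b1 => /(_ isT) H.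
by rewrite -ler_pdivlMl ?subr_gt0// mulr1.
Qed.

End expectation_bounds.

(** * The direction computed from an infinite past *)

Section limit_direction.
Context {R : realType} (a b e : R).
Hypotheses (e0 : 0 < e) (a01 : 0 <= a < 1) (b01 : a ^+ 2 < b < 1).

Let a0 : 0 <= a. Proof. by case/andP: a01. Qed.
Let b0 : 0 < b. Proof. by case/andP: b01 => + _; apply: le_lt_trans; exact: sqr_ge0. Qed.
Let b1 : b < 1. Proof. by case/andP: b01. Qed.
Let a1 : 0 < 1 - a. Proof. by rewrite subr_gt0; case/andP: a01. Qed.

(** The direction computed from an infinite past, up to the factor [1 - a]. *)
Definition limit_direction (x : nat -> R) : R :=
  (Num.sqrt ((1 - b) * limn (series (fun k => b ^+ k * `|x k| ^+ 2))) + e)^-1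
  * limn (series (fun k => a ^+ k * x k)).

Let energyE n x : energy b n x = (1 - b) * series (fun k => b ^+ k * `|x k| ^+ 2) n.
Proof.
rewrite /energy /series/= big_mkord; congr (_ * _); apply: eq_bigr => i _.
by rewrite real_normK ?num_real.
Qed.

Let momentumE n x : momentum a n x = (1 - a) * series (fun k => a ^+ k * x k) n.
Proof. by rewrite /momentum /series/= big_mkord. Qed.

(** The momentum series converges absolutely as soon as the energy series
converges, again by [a ^+ 2 < b]. *)
Lemma cvg_series_momentum x : cvgn (series (fun k => b ^+ k * `|x k| ^+ 2)) ->
  cvgn (series (fun k => a ^+ k * x k)).
Proof.
move=> cx; apply: normed_cvg; apply: nondecreasing_is_cvgn.
  by apply/nondecreasing_seqP => n; rewrite /= /series/= big_nat_recr//= lerDl.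
set M := limn (series _) in cx.
exists ((1 - a)^-1 * (dirbound a b * Num.sqrt ((1 - b) * M))) => _ [n _ <-] /=.
rewrite ler_pdivlMl//.
have -> : (1 - a) * [normed series (fun k => a ^+ k * x k)] n
    = momentum a n (fun k => `|x k|).
  rewrite /momentum /normed_series_of /series/= big_mkord; congr (_ * _); apply: eq_bigr => i _.
  by rewrite normrM ger0_norm// exprn_ge0.
apply: le_trans (ler_norm _) _; apply: le_trans (normr_momentum_le a01 b01 _ _) _.
rewrite (ler_wpM2l (ltW (dirbound_gt0 a01 b01)))// ler_wsqrtr// energyE.
rewrite ler_wpM2l ?subr_ge0 ?(ltW b1)//.
under eq_fun do rewrite normr_id.
apply: nondecreasing_cvgn_le => //; apply/nondecreasing_seqP => k.
by rewrite /series/= big_nat_recr//= lerDl mulr_ge0 ?exprn_ge0 ?sqr_ge0// ltW.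
Qed.

Lemma cvg_direction x : cvgn (series (fun k => b ^+ k * `|x k| ^+ 2)) ->
  direction a b e n x @[n --> \oo] --> (1 - a) * limit_direction x.
Proof.
move=> cx; have cm := cvg_series_momentum cx.
have -> : (fun n => direction a b e n x) = fun n =>
    (Num.sqrt ((1 - b) * series (fun k => b ^+ k * `|x k| ^+ 2) n) + e)^-1
    * ((1 - a) * series (fun k => a ^+ k * x k) n).
  by apply/funext => n; rewrite /direction energyE momentumE.
rewrite /limit_direction mulrCA; apply: cvgM; last by apply: cvgM; [exact: cvg_cst|exact: cm].
apply: cvgV; first by rewrite gt_eqF// ltr_wpDl ?sqrtr_ge0.
apply: cvgD; last exact: cvg_cst.
apply: continuous_cvg; first exact: sqrt_continuous.
by apply: cvgM; [exact: cvg_cst|exact: cx].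
Qed.

Context {d0 : measure_display} {T : measurableType d0} (P : probability T R).
Variables (x : nat -> T -> R) (c : R).
Hypotheses (mx : forall i, measurable_fun setT (x i))
  (xc : forall i, (\int[P]_w (x i w ^+ 2)%:E <= c%:E)%E).

Lemma ae_cvg_series_energy :
  {ae P, forall w, cvgn (series (fun k => b ^+ k * `|x k w| ^+ 2))}.
Proof.
pose u k (w : T) := b ^+ k * `|x k w| ^+ 2.
have u0 k (w : T) : 0 <= u k w by rewrite mulr_ge0 ?sqr_ge0 ?exprn_ge0// ltW.
have mu k : measurable_fun setT (EFin \o u k).
  apply/measurable_EFinP; apply: measurable_funM => //; apply: measurable_funX.
  exact: measurableT_comp.
pose s (w : T) := (\sum_(k <oo) (u k w)%:E)%E.
have s0 (w : T) : (0 <= s w)%E by apply: nneseries_ge0 => k _ _; rewrite lee_fin.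
have ms : measurable_fun setT s.
  apply: (@ge0_emeasurable_sum _ _ _ setT (fun k w => (u k w)%:E) xpredT)
    => [k w _ _|k _]; [by rewrite lee_fin|exact: mu].
have soo : (\int[P]_w s w < +oo)%E.
  rewrite integral_nneseries//; last by move=> k w _; rewrite lee_fin.
  have c0 : 0 <= c.
    rewrite -lee_fin; apply: le_trans (xc 0%N); apply: integral_ge0 => w _.
    by rewrite lee_fin sqr_ge0.
  apply: (@le_lt_trans _ _ (\sum_(k <oo) (b ^+ k * c)%:E)%E).
    apply: lee_nneseries => [k _ _|k _]; first by apply: integral_ge0 => w _; rewrite lee_fin.
    rewrite /u; under eq_integral do rewrite real_normK ?num_real// EFinM.
    rewrite ge0_integralZl//; last 3 first.
    - by apply/measurable_EFinP; exact: measurable_funX.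
    - by move=> w _; rewrite lee_fin sqr_ge0.
    - by rewrite lee_fin exprn_ge0// ltW.
    by rewrite EFinM lee_wpmul2l ?lee_fin ?exprn_ge0// ltW.
  apply: (@le_lt_trans _ _ ((1 - b)^-1 * c)%:E); last exact: ltry.
  apply: lime_le; first by apply: is_cvg_nneseries => k _ _; rewrite lee_fin mulr_ge0 ?exprn_ge0// ltW.
  apply: nearW => n; rewrite sumEFin lee_fin big_mkord -mulr_suml ler_wpM2r//.
  by apply: sum_geom_le; rewrite (ltW b0).
have si : P.-integrable setT s.
  apply/integrableP; split => //.
  by under eq_integral do rewrite gee0_abs//.
have := integrable_ae measurableT si; apply: filterS => w /(_ I) sw.
apply: nondecreasing_is_cvgn.
  by apply/nondecreasing_seqP => n; rewrite /series/= big_nat_recr//= lerDl; exact: u0.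
exists (fine (s w)) => _ [n _ <-]; rewrite -lee_fin fineK//.
rewrite /series/= -sumEFin; apply: nneseries_lim_ge => k _ _.
by rewrite lee_fin; exact: u0.
Qed.

(** Bounded convergence: the directions are bounded by [dirbound]. *)
Lemma cvg_Rintegral_direction :
  (\int[P]_w direction a b e n (x ^~ w)) @[n --> \oo] -->
  (1 - a) * fine 'E_P[fun w => limit_direction (x ^~ w)].
Proof.
pose g n (w : T) := (1 - a)^-1 * direction a b e n (x ^~ w).
have mdir n : measurable_fun setT (fun w => direction a b e n (x ^~ w)).
  exact: measurable_direction.
have mg n : measurable_fun setT (g n) by exact: measurable_funM.
have gb n (w : T) : `|g n w| <= (1 - a)^-1 * dirbound a b.
  rewrite normrM ger0_norm ?invr_ge0 ?(ltW a1)// ler_wpM2l ?invr_ge0 ?(ltW a1)//.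
  exact: direction_bound.
have mlim : measurable_fun setT (fun w => limit_direction (x ^~ w)).
  apply: measurable_funM; last first.
    apply: measurable_fun_limn => n; rewrite /series/=.
    by apply: measurable_sum => k; exact: measurable_funM.
  apply: measurable_fun_invr_pos => [w|]; first by rewrite ltr_wpDl ?sqrtr_ge0.
  apply: measurable_funD => //; apply: measurable_fun_sqrt.
  apply: measurable_funM => //; apply: measurable_fun_limn => n; rewrite /series/=.
  apply: measurable_sum => k; apply: measurable_funM => //; apply: measurable_funX.
  exact: measurableT_comp.
have [|||||ilim _ cvgi] := @dominated_convergence _ _ _ P setT measurableT
    (fun n => EFin \o g n) (EFin \o fun w => limit_direction (x ^~ w))
    (fun=> ((1 - a)^-1 * dirbound a b)%:E).
- by move=> n; exact/measurable_EFinP.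
- exact/measurable_EFinP.
- apply: filterS ae_cvg_series_energy => w cw _; apply/fine_cvgP; split.
    exact: nearW.
  rewrite /comp/= [X in _ --> X](_ : _ =
    (1 - a)^-1 * ((1 - a) * limit_direction (x ^~ w))); last first.
    by rewrite mulrA mulVf ?mul1r// gt_eqF.
  by apply: cvgM; [exact: cvg_cst|exact: cvg_direction].
- exact: finite_measure_integrable_cst.
- by apply: aeW => w n _; rewrite lee_fin.
have -> : (fun n => \int[P]_w direction a b e n (x ^~ w)) =
    fun n => (1 - a) * \int[P]_w g n w.
  apply/funext => n; rewrite -RintegralZl//; last exact: bounded_integrable (gb n).
  by apply: eq_Rintegral => w _; rewrite /g mulrA mulfV ?mul1r// gt_eqF.
apply: cvgM; first exact: cvg_cst.
have fi : ('E_P[fun w => limit_direction (x ^~ w)])%E \is a fin_num.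
  rewrite unlock; exact: integrable_fin_num ilim.
by move: cvgi fi; rewrite unlock => + fi; rewrite -{1}(fineK fi) => /fine_cvgP[].
Qed.

(** The mean directions form a Cauchy sequence with geometric rate. *)
Lemma Rintegral_direction_truncation n k :
  (\int[P]_w direction a b e (n + k) (x ^~ w)
   - \int[P]_w direction a b e n (x ^~ w)) ^+ 2
  <= dirlip a b e ^+ 2 * (b ^+ n * c).
Proof.
have mdir m : measurable_fun setT (fun w => direction a b e m (x ^~ w)).
  exact: measurable_direction.
have bdir m (w : T) := direction_bound e0 a01 b01 m (x ^~ w).
rewrite -RintegralB//; [|exact: bounded_integrable (bdir _)..].
have c0 : 0 <= c.
  rewrite -lee_fin; apply: le_trans (xc 0%N); apply: integral_ge0 => w _.
  by rewrite lee_fin sqr_ge0.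
apply: (@sqr_Rintegral_le _ _ _ P _ (dirbound a b + dirbound a b)).
- exact: measurable_funB.
- by move=> w; apply: le_trans (ler_normB _ _) _; apply: lerD; exact: bdir.
pose y (w : T) i := x (n + i)%N w.
apply: (@le_trans _ _ (\int[P]_w ((dirlip a b e ^+ 2 * b ^+ n)%:E * (energy b k (y w))%:E))%E).
  apply: ge0_le_integral => //.
  - by move=> w _; rewrite lee_fin sqr_ge0.
  - by apply/measurable_EFinP/measurable_funX; exact: measurable_funB.
  - under eq_fun do rewrite -EFinM; apply/measurable_EFinP/measurable_funM => //.
    by apply: measurable_energy => i; exact: mx.
  - move=> w _; rewrite -EFinM lee_fin.
    have := direction_truncation e0 a01 b01 n k (x ^~ w) (x ^~ w).
    rewrite [X in energy b n X](_ : _ = fun=> 0); last by apply/funext => i; rewrite subrr.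
    rewrite [energy b n _](_ : _ = 0) ?add0r ?mulrA//.
    by rewrite /energy big1 ?mulr0// => i _; rewrite expr0n mulr0.
rewrite ge0_integralZl//; last 3 first.
- by apply/measurable_EFinP; apply: measurable_energy => i; exact: mx.
- by move=> w _; rewrite lee_fin (energy_ge0 b01).
- by rewrite lee_fin mulr_ge0 ?sqr_ge0 ?exprn_ge0// ltW.
rewrite mulrA [leRHS]EFinM lee_wpmul2l//.
  by rewrite lee_fin mulr_ge0 ?sqr_ge0 ?exprn_ge0// ltW.
exact: (@integral_energy_le _ _ _ P b b0 b1 k (fun i => x (n + i)%N) c c0).
Qed.

End limit_direction.

(** * The Adam vector field *)

Lemma cvg_near_le (R : realType) (u : nat -> R) (l c : R) : u @ \oo --> l ->
  (\forall n \near \oo, u n <= c) -> l <= c.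
Proof.
by move=> ul uc; rewrite -(cvg_lim (@Rhausdorff R) ul); apply: limr_le => //; apply/cvg_ex; exists l.
Qed.

Lemma cvg_sqr_dist_le (R : realType) (u v : nat -> R) (l l' c : R) :
  u @ \oo --> l -> v @ \oo --> l' ->
  (\forall n \near \oo, (u n - v n) ^+ 2 <= c) -> (l - l') ^+ 2 <= c.
Proof.
move=> ul vl'; apply: cvg_near_le; rewrite expr2.
by apply: cvgM; apply: cvgB.
Qed.

Lemma eq_direction (R : rcfType) (a b e : R) n x y :
  (forall i, (i < n)%N -> x i = y i) -> direction a b e n x = direction a b e n y.
Proof.
move=> xy; rewrite /direction /energy /momentum.
congr ((Num.sqrt (_ * _) + _)^-1 * (_ * _)); by apply: eq_bigr => i _; rewrite xy.
Qed.

Section vector_field.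
Context {R : realType} {dS : measure_display} {S : measurableType dS} {d : nat}
  {dO : measure_display} {Omega : measurableType dO} {P : probability Omega R}.
Variables (X : {mfun (S * 'rV[R]_d)%type >-> 'rV[R]_d}) (U : {RV P >-> S}).
Variables (a b e : R).
Hypotheses (e0 : 0 < e) (a01 : 0 <= a < 1) (b01 : a ^+ 2 < b < 1).
Variable f : 'rV[R]_d -> 'rV[R]_d.
Hypothesis f_adam : adam_vector_field X U a b e f.

Let b0 : 0 < b. Proof. by case/andP: b01 => + _; apply: le_lt_trans; exact: sqr_ge0. Qed.
Let b1 : b < 1. Proof. by case/andP: b01. Qed.

(** The innovation has second moments of at most exponential growth. *)
Definition moment_growth (c lam : R) := forall theta j,
  (\int[P]_w ((X (U w, theta) ord0 j) ^+ 2)%:E <=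
    (c * expR (lam * enorm theta))%:E)%E.

(** The innovation is Lipschitz in mean square on the ball of radius [r]. *)
Definition mean_lipschitz (r K : R) := forall theta theta',
   enorm theta <= r -> enorm theta' <= r -> forall j,
   (\int[P]_w ((X (U w, theta) ord0 j - X (U w, theta') ord0 j) ^+ 2)%:E <=
    (K * enorm (theta - theta') ^+ 2)%:E)%E.

Section copies.
Context {dQ : measure_display} {Xi : measurableType dQ} (Q : probability Xi R)
  (V : nat -> {RV Q >-> S}).
Hypothesis iidV : iid_copies U V.

Lemma moment_growth_copy c lam k theta j : moment_growth c lam ->
  (\int[Q]_w ((X (V k w, theta) ord0 j) ^+ 2)%:E <=
    (c * expR (lam * enorm theta))%:E)%E.
Proof.
move=> /(_ theta j); apply: le_trans.
rewrite (ge0_integral_copy iidV (g := fun s => ((X (s, theta) ord0 j) ^+ 2)%:E))//.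
  apply/measurable_EFinP/measurable_funX.
  exact: (measurable_innovation X (V := id) (Y := cst theta)).
by move=> s; rewrite lee_fin sqr_ge0.
Qed.

Lemma mean_lipschitz_copy r K k theta theta' j : mean_lipschitz r K ->
  enorm theta <= r -> enorm theta' <= r ->
  (\int[Q]_w ((X (V k w, theta) ord0 j - X (V k w, theta') ord0 j) ^+ 2)%:E <=
    (K * enorm (theta - theta') ^+ 2)%:E)%E.
Proof.
move=> H tr t'r; apply: le_trans (H _ _ tr t'r j).
rewrite (ge0_integral_copy iidV
  (g := fun s => ((X (s, theta) ord0 j - X (s, theta') ord0 j) ^+ 2)%:E))//.
  apply/measurable_EFinP/measurable_funX; apply: measurable_funB.
    exact: (measurable_innovation X (V := id) (Y := cst theta)).
  exact: (measurable_innovation X (V := id) (Y := cst theta')).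
by move=> s; rewrite lee_fin sqr_ge0.
Qed.

(** The direction at time [l] of the process frozen at [theta], as a function of
[theta] and of the [l] innovations, listed from the most recent one. *)
Definition frozen l j (y : 'rV[R]_d * l.-tuple S) : R :=
  direction a b e l (fun i => oapp (fun i' : 'I_l => X (tnth y.2 i', y.1) ord0 j)
                              0 (insub i)).

Lemma frozen_block l j (s : 'I_l -> nat) (theta : 'rV[R]_d) w (x : nat -> R) :
  (forall i : 'I_l, x i = X (V (s i) w, theta) ord0 j) ->
  frozen j (theta, block V s w) = direction a b e l x.
Proof.
move=> xE; apply: eq_direction => i il; rewrite insubT/=.
by rewrite -[x i]/(x (Ordinal il)) xE tnth_mktuple.
Qed.

End copies.

Lemma measurable_frozen l j : measurable_fun setT (@frozen l j).
Proof.
apply: measurable_direction => // i; case: insubP => [i' _ _|_] /=; last exact: measurable_cst.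
apply: (measurable_innovation X (V := fun y => tnth y.2 i') (Y := fst)) => //.
exact: (measurableT_comp (measurable_tnth i')).
Qed.

Lemma frozen_bound l j y : `|@frozen l j y| <= dirbound a b.
Proof. exact: direction_bound. Qed.

Section field_properties.
Variables (c lam : R).
Hypothesis Xgrowth : moment_growth c lam.

Let cvg_field : exists (dQ : measure_display) (Xi : measurableType dQ)
    (Q : probability Xi R) (V : nat -> {RV Q >-> S}), iid_copies U V /\
  forall theta j,
   (\int[Q]_w direction a b e n (fun k => X (V k w, theta) ord0 j)) @[n --> \oo]
     --> f theta ord0 j.
Proof.
have [dQ [Xi [Q [V [iidV fE]]]]] := f_adam.
exists dQ, Xi, Q, V; split => // theta j; rewrite fE.
apply: (cvg_Rintegral_direction e0 a01 b01
  (x := fun k w => X (V k w, theta) ord0 j)) => [k|k].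
  exact: (measurable_innovation X (Y := cst theta)).
exact: moment_growth_copy.
Qed.

Let mdir dQ (Xi : measurableType dQ) (Q : probability Xi R) (V : nat -> {RV Q >-> S})
  n theta j :
  measurable_fun setT (fun w => direction a b e n (fun k => X (V k w, theta) ord0 j)).
Proof.
apply: (measurable_direction _ _ _ (x := fun k w => X (V k w, theta) ord0 j)) => // k.
exact: (measurable_innovation X (Y := cst theta)).
Qed.

Lemma field_bound theta j : `|f theta ord0 j| <= dirbound a b.
Proof.
have [dQ [Xi [Q [V [iidV /(_ theta j) fE]]]]] := cvg_field.
apply: cvg_near_le (cvg_norm fE) _; apply: nearW => n.
apply: le_trans (le_normr_Rintegral _ (bounded_integrable Q _ _)) _ => //.
  by move=> w; exact: direction_bound.
rewrite (@le_trans _ _ (\int[Q]_w (dirbound a b)))//.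
  apply: le_Rintegral => //.
  - apply: (@bounded_integrable _ _ _ Q _ (dirbound a b)); first exact: measurableT_comp.
    by move=> w; rewrite normr_id; exact: direction_bound.
  - exact: finite_measure_integrable_cst.
  - by move=> w _; exact: direction_bound.
by rewrite /Rintegral integral_cst_probability.
Qed.

(** The vector field inherits the local Lipschitz property of the innovation. *)
Lemma field_lipschitz r K theta theta' j : 0 <= K -> mean_lipschitz r K ->
  enorm theta <= r -> enorm theta' <= r ->
  (f theta ord0 j - f theta' ord0 j) ^+ 2 <=
  dirlip a b e ^+ 2 * (K * enorm (theta - theta') ^+ 2).
Proof.
move=> K0 Klip tr t'r.
have [dQ [Xi [Q [V [iidV fE]]]]] := cvg_field.
apply: (cvg_sqr_dist_le (fE theta j) (fE theta' j)); apply: nearW => n.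
set u := fun w => direction a b e n (fun k => X (V k w, theta) ord0 j).
set v := fun w => direction a b e n (fun k => X (V k w, theta') ord0 j).
have ub w : `|u w| <= dirbound a b by exact: direction_bound.
have vb w : `|v w| <= dirbound a b by exact: direction_bound.
have mu : measurable_fun setT u by exact: mdir.
have mv : measurable_fun setT v by exact: mdir.
rewrite -RintegralB//; [|exact: (bounded_integrable _ _ ub)|exact: (bounded_integrable _ _ vb)].
apply: (@sqr_Rintegral_le _ _ _ Q _ (dirbound a b + dirbound a b)).
- exact: measurable_funB.
- by move=> w; apply: le_trans (ler_normB _ _) _; apply: lerD; [exact: ub|exact: vb].
pose y k w := X (V k w, theta) ord0 j - X (V k w, theta') ord0 j.
have my k : measurable_fun setT (y k).
  apply: measurable_funB; [exact: (measurable_innovation X (Y := cst theta))|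
    exact: (measurable_innovation X (Y := cst theta'))].
apply: (@le_trans _ _ (\int[Q]_w ((dirlip a b e ^+ 2)%:E * (energy b n (y ^~ w))%:E))%E).
  apply: ge0_le_integral => //.
  - by move=> w _; rewrite lee_fin sqr_ge0.
  - by apply/measurable_EFinP/measurable_funX; exact: measurable_funB.
  - under eq_fun do rewrite -EFinM; apply/measurable_EFinP/measurable_funM => //.
    exact: measurable_energy.
  - by move=> w _; rewrite -EFinM lee_fin; exact: direction_lipschitz.
rewrite ge0_integralZl//; last 3 first.
- by apply/measurable_EFinP; exact: measurable_energy.
- by move=> w _; rewrite lee_fin (energy_ge0 b01).
- by rewrite lee_fin sqr_ge0.
rewrite [leRHS]EFinM lee_wpmul2l//; first by rewrite lee_fin sqr_ge0.
apply: (integral_energy_le b0 b1) => [|i _|i _].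
- by rewrite mulr_ge0// sqr_ge0.
- exact: my.
- exact: (mean_lipschitz_copy iidV i j Klip tr t'r).
Qed.

(** The vector field is a limit of mean directions, which are measurable by Fubini's
theorem after a shift that makes the integrand nonnegative. *)
Lemma measurable_field j : measurable_fun setT (fun theta => f theta ord0 j).
Proof.
have [dQ [Xi [Q [V [iidV fE]]]]] := cvg_field.
apply: measurable_fun_cvg => [n|theta _]; last exact: fE.
pose g (y : 'rV[R]_d * Xi) :=
  (direction a b e n (fun k => X (V k y.2, y.1) ord0 j) + dirbound a b)%:E.
have mg : measurable_fun setT g.
  apply/measurable_EFinP/measurable_funD => //.
  apply: (measurable_direction _ _ _ (x := fun k y => X (V k y.2, y.1) ord0 j)) => // k.
  apply: (measurable_innovation X (V := fun y => V k y.2) (Y := fst)) => //.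
  exact: (measurableT_comp (f := V k)).
have g0 y : (0 <= g y)%E.
  have := direction_bound e0 a01 b01 n (fun k => X (V k y.2, y.1) ord0 j).
  by rewrite ler_norml lee_fin -lerBlDr sub0r => /andP[].
have mF := measurable_fun_fubini_tonelli_F (m2 := Q) g mg g0.
rewrite (_ : (fun theta => _) = fun theta =>
    fine (fubini_F Q g theta) - dirbound a b); last first.
  apply/funext => theta; rewrite /fubini_F /g/=.
  have := @RintegralD _ _ _ Q setT
    (fun w => direction a b e n (fun k => X (V k w, theta) ord0 j))
    (fun=> dirbound a b) measurableT.
  rewrite /Rintegral => ->; last 2 first.
  - apply: (@bounded_integrable _ _ _ Q _ (dirbound a b)); first exact: mdir.
    by move=> w; exact: direction_bound.
  - exact: finite_measure_integrable_cst.
  by rewrite integral_cst_probability/= addrK.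
apply: measurable_funB => //.
exact: (measurableT_comp (fine_measurable measurableT)).
Qed.

(** The mean of the frozen direction is close to the vector field, on whatever
probability space the copies live. *)
Lemma frozen_mean_dist dQ (Xi : measurableType dQ) (Q : probability Xi R)
    (V : nat -> {RV Q >-> S}) l (s : 'I_l -> nat) theta j :
  iid_copies U V -> injective s ->
  (\int[Q]_w frozen j (theta, block V s w) - f theta ord0 j) ^+ 2 <=
  dirlip a b e ^+ 2 * (b ^+ l * (c * expR (lam * enorm theta))).
Proof.
move=> iidV sinj.
have [dQ' [Xi' [Q' [V' [iidV' fE]]]]] := cvg_field.
have -> : \int[Q]_w frozen j (theta, block V s w) =
    \int[Q']_w direction a b e l (fun k => X (V' k w, theta) ord0 j).
  rewrite /Rintegral (bounded_integral_block iidV iidV' (s := s) (s' := @nat_of_ord l)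
    (g := fun z => frozen j (theta, z)) (c := dirbound a b))//.
  - by congr fine; apply: eq_integral => w _; congr EFin; apply: frozen_block.
  - exact: ord_inj.
  - by apply: (measurableT_comp (@measurable_frozen l j)); exact: measurable_fun_pair.
  - by move=> z; exact: frozen_bound.
set u := \int[Q']_w direction a b e l _.
apply: (cvg_sqr_dist_le (cvg_cst u) (fE theta j)); near=> n.
have ln : (l <= n)%N by near: n; exact: nbhs_infty_ge.
rewrite -sqrrN opprB -(subnKC ln).
apply: (Rintegral_direction_truncation e0 a01 b01
  (x := fun k w => X (V' k w, theta) ord0 j)) => [k|k].
  exact: (measurable_innovation X (Y := cst theta)).
exact: moment_growth_copy.
Unshelve. all: by end_near. Qed.

End field_properties.
End vector_field.

(** * Integrating over fresh innovations *)

Section fresh.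
Context {R : realType} {dS : measure_display} {S : measurableType dS}
  {dO : measure_display} {Omega : measurableType dO} (P : probability Omega R).
Variable V : nat -> {RV P >-> S}.
Hypothesis indV : mutually_independent V.

(** The probability space with the sigma-algebra of the first [n] innovations. *)
Definition past n := g_sigma_algebraType (cylinders V `I_n).

Lemma measurable_past_le n k dT (T : measurableType dT) (Y : Omega -> T) :
  (n <= k)%N -> measurable_fun setT (Y : past n -> T) ->
  measurable_fun setT (Y : past k -> T).
Proof.
by move=> nk; apply: measurable_cylindersS => i /= /leq_trans; exact.
Qed.

Lemma measurable_past n dT (T : measurableType dT) (Y : Omega -> T) :
  measurable_fun setT (Y : past n -> T) -> measurable_fun setT Y.
Proof. by apply: measurable_cylindersT => i; exact: measurable_funPT. Qed.

Lemma measurable_past_var n k : (k < n)%N ->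
  measurable_fun setT (V k : past n -> S).
Proof. by move=> kn; exact: measurable_cylinders_var. Qed.

Lemma past_indep n (J : set nat) dT (T : measurableType dT) (Z : Omega -> T) :
  (forall i, J i -> (n <= i)%N) ->
  measurable_fun setT (Z : g_sigma_algebraType (cylinders V J) -> T) ->
  forall (A : set (past n)) B, measurable A -> measurable B ->
  P ((id : Omega -> past n) @^-1` A `&` Z @^-1` B) =
  (P ((id : Omega -> past n) @^-1` A) * P (Z @^-1` B))%E.
Proof.
move=> nJ mZ; apply: (indep_cylinders indV (I := `I_n) (J := J)) => //.
by apply/seteqP; split => // i [/= im /nJ]; rewrite leqNgt im.
Qed.

(** Integral of a function of the past of time [t] and of the innovation [V t]. *)
Lemma fresh_integral_le t (g : past t * S -> R) (c : R) :
  measurable_fun setT g -> (forall y, 0 <= g y) ->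
  (forall w, (\int[P]_w' (g (w, V t w'))%:E <= c%:E)%E) ->
  (\int[P]_w (g (w, V t w))%:E <= c%:E)%E.
Proof.
move=> mg g0 gc.
have mid : measurable_fun setT (id : Omega -> past t).
  exact: (measurable_past (n := t) (Y := id : Omega -> past t)).
have mVt : measurable_fun setT (V t : g_sigma_algebraType (cylinders V [set t]) -> S).
  exact: measurable_cylinders_var.
have mgE : measurable_fun setT (EFin \o g) by exact/measurable_EFinP.
have gE0 y : (0 <= (EFin \o g) y)%E by rewrite lee_fin.
have ind : forall (A : set (past t)) B, measurable A -> measurable B ->
    P ((id : Omega -> past t) @^-1` A `&` V t @^-1` B) =
    (P ((id : Omega -> past t) @^-1` A) * P (V t @^-1` B))%E.
  by apply: (@past_indep t [set t] _ _ (V t)) => // i ->.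
have mVt' : measurable_fun setT (V t) by [].
rewrite (ge0_integral_indep mid mVt' ind mgE gE0).
rewrite -(integral_cst_probability P c); apply: ge0_le_integral => //.
- by move=> w _; apply: integral_ge0 => w' _; rewrite lee_fin.
- pose h (y : Omega * Omega) := (g (y.1, V t y.2))%:E.
  apply: (measurable_fun_fubini_tonelli_F (m2 := P) h).
    apply/measurable_EFinP; apply: (measurableT_comp mg).
    apply: measurable_fun_pair; first exact: (measurableT_comp mid measurable_fst).
    exact: (measurableT_comp mVt' measurable_snd).
  by move=> y; rewrite lee_fin.
- by move=> w _; exact: gc.
Qed.

(** Integral of a function [g] of the past and of a block of later innovations,
against a function [Y] of the past: only the mean of [g] over the block matters. *)
Lemma fresh_Rintegral_le n l (s : 'I_l -> nat) (Y : past n -> R)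
    (g : past n * l.-tuple S -> R) (c k eps : R) :
  (forall i, (n <= s i)%N) -> measurable_fun setT Y -> measurable_fun setT g ->
  (forall w, `|Y w| <= c) -> (forall y, `|g y| <= k) ->
  (forall w, `|Y w * \int[P]_w' g (w, block V s w')| <= eps) ->
  `|\int[P]_w (Y w * g (w, block V s w))| <= eps.
Proof.
move=> ns mY mg Yc gk Yg.
have mid : measurable_fun setT (id : Omega -> past n).
  exact: (measurable_past (n := n) (Y := id : Omega -> past n)).
pose J := [set i | exists i', s i' = i].
have mZ : measurable_fun setT
    (block V s : g_sigma_algebraType (cylinders V J) -> l.-tuple S).
  apply/measurable_fun_tnthP => i.
  rewrite (_ : _ \o _ = V (s i)); first by apply: measurable_cylinders_var; exists i.
  by apply/funext => w; rewrite /= tnth_mktuple.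
pose h (y : past n * l.-tuple S) := Y y.1 * g y.
have mh : measurable_fun setT h.
  by apply: measurable_funM => //; exact: (measurableT_comp mY).
have hb y : `|h y| <= c * k by rewrite normrM; exact: ler_pM.
have mZ' := measurable_block V s.
rewrite /Rintegral (bounded_integral_indep (P := P) (Y := id : Omega -> past n)
  (Z := block V s) mid mZ' _ mh hb); last first.
  by apply: (past_indep (J := J)) => // i [i' <-].
have inner w : (\int[P]_w' (h (w, block V s w'))%:E)%E =
    (Y w * \int[P]_w' g (w, block V s w'))%:E.
  have gi : P.-integrable setT (EFin \o (fun w' => g (w, block V s w'))).
    apply: (@bounded_integrable _ _ _ P _ k) => //.
    by apply: (measurableT_comp mg); exact: measurable_fun_pair.
  rewrite -RintegralZl//= /Rintegral fineK//.
  apply: integrable_fin_num => //; rewrite /comp.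
  by under eq_fun do rewrite EFinM; exact: integrableZl.
have mF : measurable_fun setT (fun w : Omega => Y w * \int[P]_w' g (w, block V s w')).
  pose H := EFin \o fun y : Omega * Omega => h (y.1, block V s y.2).
  have HI : (P \x P)%E.-integrable setT H.
    apply: (bounded_integrable _ (c := c * k)) => //.
    apply: (measurableT_comp mh); apply: measurable_fun_pair.
      exact: (measurableT_comp mid measurable_fst).
    exact: (measurableT_comp mZ' measurable_snd).
  apply/measurable_EFinP.
  rewrite (_ : _ \o _ = fubini_F P H); first exact: (measurable_fubini_F HI).
  by apply/funext => w; rewrite /fubini_F /H/= inner.
under eq_integral do rewrite inner.
have iF := bounded_integrable P mF Yg.
apply: le_trans (le_normr_Rintegral _ iF) _ => //.
rewrite [leRHS](_ : _ = \int[P]_w eps); last by rewrite /Rintegral integral_cst_probability.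
apply: le_Rintegral => //; last exact: finite_measure_integrable_cst.
apply: (@bounded_integrable _ _ _ P _ eps); first exact: measurableT_comp.
by move=> w; rewrite normr_id.
Qed.

End fresh.

(** * The Adam process *)

Lemma window_sub n l t i : (n + l <= t)%N -> (i < l)%N -> (n <= t - i)%N.
Proof. lia. Qed.

Lemma window_start n l t : (n + l <= t)%N -> (n <= t.+1 - l)%N.
Proof. lia. Qed.

Lemma window_inj n l t i i' : (n + l <= t)%N -> (i < l)%N -> (i' < l)%N ->
  (t - i = t - i')%N -> i = i'.
Proof. lia. Qed.

Lemma window_shift n k t : (t < k - n)%N -> (t + n < k)%N.
Proof. lia. Qed.

Lemma window_before n l k : (n + l <= k)%N -> (n <= k - l)%N.
Proof. lia. Qed.

Lemma small_eventually (R : realType) (M e : R) (u : nat -> R) :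
  u @ \oo --> 0 -> 0 < e ->
  exists n0 : nat, forall n, (n0 <= n)%N -> M * u n <= e.
Proof.
move=> u0 e0; have : (fun n => M * u n) @ \oo --> M * 0.
  by apply: cvgM; [exact: cvg_cst|exact: u0].
rewrite mulr0 => /cvgr_le/(_ _ e0)[n0 _ H]; exists n0 => n; exact: H.
Qed.

Section adam_process.
Context {R : realType} {dS : measure_display} {S : measurableType dS} {d : nat}
  {dO : measure_display} {Omega : measurableType dO} {P : probability Omega R}.
Variables (X : {mfun (S * 'rV[R]_d)%type >-> 'rV[R]_d}) (U : {RV P >-> S}).
Variables (a b e : R).
Hypotheses (e0 : 0 < e) (a01 : 0 <= a < 1) (b01 : a ^+ 2 < b < 1).
Variable gamma : nat -> R.
Hypotheses (gamma_gt0 : forall n, (1 <= n)%N -> 0 < gamma n)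
  (gamma_decr : forall m n, (1 <= m)%N -> (m <= n)%N -> gamma n <= gamma m)
  (gamma_cvg0 : gamma @ \oo --> (0 : R)).
Variables (vartheta : 'rV[R]_d) (theta m v sigma : nat -> Omega -> 'rV[R]_d)
  (V : nat -> {RV P >-> S}).
Hypothesis iidV : iid_copies U V.
Hypothesis init : forall w, [/\ theta 0%N w = vartheta, m 0%N w = 0 & v 0%N w = 0].
Hypothesis step : forall (n : nat) (w : Omega),
  m n.+1 w = a *: m n w + (1 - a) *: X (V n w, theta n w) /\
  forall j : 'I_d,
  [/\ v n.+1 w ord0 j = b * v n w ord0 j
        + (1 - b) * (X (V n w, theta n w) ord0 j) ^+ 2,
      sigma n.+1 w ord0 j =
        (Num.sqrt (v n.+1 w ord0 j / (1 - b ^+ n.+1)) + e)^-1 &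
      theta n.+1 w ord0 j = theta n w ord0 j
        + gamma n.+1 * sigma n.+1 w ord0 j * m n.+1 w ord0 j].

Let b0 : 0 < b. Proof. by case/andP: b01 => + _; apply: le_lt_trans; exact: sqr_ge0. Qed.
Let b1 : b < 1. Proof. by case/andP: b01. Qed.
Let indV : mutually_independent V := iidV.1.

(** The innovations met by the process, listed backwards from time [n]; only the
indices [i < n] are meaningful. *)
Definition innovations n j w (i : nat) : R :=
  X (V (n - i.+1) w, theta (n - i.+1)%N w) ord0 j.

Let innovationsS n j w : (fun i => innovations n.+1 j w i.+1) = innovations n j w.
Proof. by apply/funext => i; rewrite /innovations subSS. Qed.

Lemma adam_momentum n j w : m n w ord0 j = momentum a n (innovations n j w).
Proof.
elim: n => [|n ih]; first by have [_ -> _] := init w; rewrite mxE /momentum big_ord0 mulr0.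
rewrite momentumS innovationsS -ih (step n w).1 !mxE.
by rewrite /innovations subn1.
Qed.

Lemma adam_energy n j w : v n w ord0 j = energy b n (innovations n j w).
Proof.
elim: n => [|n ih]; first by have [_ _ ->] := init w; rewrite mxE /energy big_ord0 mulr0.
have [-> _ _] := (step n w).2 j.
by rewrite energyS innovationsS -ih /innovations subn1.
Qed.

(** A step of the process divided by its step size. *)
Definition increment n w j : R := sigma n.+1 w ord0 j * m n.+1 w ord0 j.

Lemma theta_increment n w j :
  theta n.+1 w ord0 j - theta n w ord0 j = gamma n.+1 * increment n w j.
Proof. by have [_ _ ->] := (step n w).2 j; rewrite addrAC subrr add0r mulrA. Qed.

Let bn n : 0 <= b ^+ n.+1 < 1.
Proof. by rewrite exprn_ge0 ?exprn_ilt1// ltW. Qed.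

Let v0 n w j : 0 <= v n w ord0 j.
Proof. by rewrite adam_energy; exact: energy_ge0 b01 _ _. Qed.

Let mv n w j : `|m n w ord0 j| <= dirbound a b * Num.sqrt (v n w ord0 j).
Proof. by rewrite adam_energy adam_momentum; exact: normr_momentum_le. Qed.

Lemma increment_bound n w j : `|increment n w j| <= dirbound a b.
Proof.
rewrite /increment; have [_ -> _] := (step n w).2 j.
have /andP[bn0 bn1] := bn n.
have r0 : 0 < 1 - b ^+ n.+1 by rewrite subr_gt0.
apply: (norm_div_sqrt_le e0 a01 b01); first by rewrite divr_ge0// ltW.
apply: le_trans (mv _ _ _) _; rewrite (ler_wpM2l (ltW (dirbound_gt0 a01 b01)))//.
rewrite ler_wsqrtr// ler_pdivlMr// ler_piMr// gerBl//.
Qed.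

(** Without the bias correction, which fades out geometrically, a step is the
direction of the innovations met so far. *)
Lemma increment_direction n w j :
  `|increment n w j - direction a b e n.+1 (innovations n.+1 j w)|
  <= dirbound a b * b ^+ n.+1.
Proof.
rewrite /increment; have [_ -> _] := (step n w).2 j.
rewrite /direction -adam_energy -adam_momentum.
exact: (bias_correction_le e0 a01 b01).
Qed.

(** The mass of the step sizes between times [n] and [k]. *)
Definition mass n k : R := \sum_(n <= t < k) gamma t.+1.

Lemma mass_ge0 n k : 0 <= mass n k.
Proof. by apply: sumr_ge0 => t _; rewrite ltW// gamma_gt0. Qed.

Lemma mass_le n k k' : (k <= k')%N -> mass n k <= mass n k'.
Proof.
move=> kk'; have [nk|kn] := leqP n k; last by rewrite {1}/mass big_geq ?mass_ge0// ltnW.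
by rewrite /mass (big_cat_nat nk kk')/= lerDl mass_ge0.
Qed.

Lemma theta_sum n k w j : (n <= k)%N -> theta k w ord0 j - theta n w ord0 j =
  \sum_(n <= t < k) gamma t.+1 * increment t w j.
Proof.
move=> nk; under eq_bigr do rewrite -theta_increment.
by rewrite (telescope_sumr (fun t => theta t w ord0 j)).
Qed.

(** The process moves at bounded speed with respect to the mass of the steps. *)
Lemma theta_dist n k w : (n <= k)%N ->
  enorm (theta k w - theta n w) <= d%:R * (dirbound a b * mass n k).
Proof.
move=> nk; apply: enorm_le_coord => [|j].
  by rewrite mulr_ge0 ?mass_ge0// ltW// dirbound_gt0.
rewrite !mxE theta_sum// mulr_sumr; apply: le_trans (ler_norm_sum _ _ _) _.
apply: ler_sum => t _; rewrite normrM gtr0_norm ?gamma_gt0// mulrC.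
by rewrite ler_wpM2r ?increment_bound// ltW// gamma_gt0.
Qed.

Lemma measurable_adam n :
  [/\ measurable_fun setT (theta n : past V n -> 'rV[R]_d),
      forall j, measurable_fun setT (fun w : past V n => m n w ord0 j) &
      forall j, measurable_fun setT (fun w : past V n => v n w ord0 j)].
Proof.
elim: n => [|n [mth mm mvn]].
  split=> [|j|j].
  - rewrite (_ : theta 0%N = cst vartheta)//; by apply/funext => w; have [-> _ _] := init w.
  - rewrite (_ : (fun w => _) = cst 0)//; by apply/funext => w; have [_ -> _] := init w; rewrite mxE.
  - rewrite (_ : (fun w => _) = cst 0)//; by apply/funext => w; have [_ _ ->] := init w; rewrite mxE.
have up dT (T : measurableType dT) (Y : Omega -> T) :
    measurable_fun setT (Y : past V n -> T) -> measurable_fun setT (Y : past V n.+1 -> T).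
  exact: measurable_past_le.
have mX j : measurable_fun setT (fun w : past V n.+1 => X (V n w, theta n w) ord0 j).
  apply: (measurable_innovation X (V := V n : past V n.+1 -> S)); first exact: measurable_past_var.
  exact: up.
have mmS j : measurable_fun setT (fun w : past V n.+1 => m n.+1 w ord0 j).
  rewrite (_ : (fun w => _) = fun w => a * m n w ord0 j + (1 - a) * X (V n w, theta n w) ord0 j).
    apply: measurable_funD; apply: measurable_funM => //.
    exact: (up _ _ (fun w => m n w ord0 j)).
  by apply/funext => w; rewrite (step n w).1 !mxE.
have mvS j : measurable_fun setT (fun w : past V n.+1 => v n.+1 w ord0 j).
  rewrite (_ : (fun w => _) = fun w => b * v n w ord0 j + (1 - b) * X (V n w, theta n w) ord0 j ^+ 2).
    apply: measurable_funD; apply: measurable_funM => //; last exact: measurable_funX.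
    exact: (up _ _ (fun w => v n w ord0 j)).
  by apply/funext => w; have [-> _ _] := (step n w).2 j.
split => //; apply/measurable_fun_rV => j.
rewrite (_ : (fun w => _) = fun w => theta n w ord0 j + gamma n.+1 *
   (Num.sqrt (v n.+1 w ord0 j / (1 - b ^+ n.+1)) + e)^-1 * m n.+1 w ord0 j).
  apply: measurable_funD.
    by apply: up; apply/measurable_fun_rV: j.
  apply: measurable_funM => //; apply: measurable_funM => //.
  apply: measurable_fun_invr_pos => [w|]; first by rewrite ltr_wpDl ?sqrtr_ge0.
  apply: measurable_funD => //; apply: measurable_fun_sqrt.
  exact: measurable_funM.
by apply/funext => w; have [_ <- ->] := (step n w).2 j.
Qed.

Lemma measurable_theta_past n k : (n <= k)%N ->
  measurable_fun setT (theta n : past V k -> 'rV[R]_d).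
Proof. by move=> nk; apply: (measurable_past_le nk); have [] := measurable_adam n. Qed.

Lemma measurable_theta n : measurable_fun setT (theta n).
Proof. by apply: (measurable_past (V := V) (n := n)); have [] := measurable_adam n. Qed.

Let mX t j : measurable_fun setT (fun w => X (V t w, theta t w) ord0 j).
Proof. by apply: (measurable_innovation X (V := V t)) => //; exact: measurable_theta. Qed.

Let menergy t j : measurable_fun setT (fun w => v t w ord0 j).
Proof. by apply: (measurable_past (V := V) (n := t)); have [] := measurable_adam t. Qed.

Section weighted_energy.
Variables (c lam : R) (j : 'I_d).
Hypotheses (lam0 : 0 <= lam) (c0 : 0 <= c) (Xgrowth : moment_growth X U c lam).

(** The weight that compensates the exponential growth of the second moments. *)
Definition weight t w : R := expR (- (lam * enorm (theta t w))).

Lemma weight_ge0 t w : 0 <= weight t w. Proof. exact: expR_ge0. Qed.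

#[local] Hint Resolve weight_ge0 : core.

Lemma measurable_weight t : measurable_fun setT (weight t).
Proof.
apply: (measurableT_comp (f := expR)) => //; apply: measurableT_comp => //.
apply: measurable_funM => //; apply: measurable_fun_enorm; exact: measurable_theta.
Qed.

#[local] Hint Resolve measurable_weight : core.

Let fresh_weight t :
  (\int[P]_w (X (V t w, theta t w) ord0 j ^+ 2 * weight t w)%:E <= c%:E)%E.
Proof.
pose g (y : past V t * S) := X (y.2, theta t y.1) ord0 j ^+ 2 * weight t y.1.
have mth := measurable_theta_past (leqnn t).
apply: (fresh_integral_le indV (g := g)).
- apply: measurable_funM.
    apply: measurable_funX; apply: (measurable_innovation X (V := snd)) => //.
    exact: (measurableT_comp mth).
  apply: (measurableT_comp (f := expR)) => //; apply: measurableT_comp => //.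
  apply: measurable_funM => //; apply: measurable_fun_enorm.
  exact: (measurableT_comp mth).
- by move=> y; rewrite mulr_ge0// sqr_ge0.
- move=> w; rewrite /g/=; under eq_integral do rewrite mulrC EFinM.
  rewrite ge0_integralZl//; last 3 first.
  + apply/measurable_EFinP/measurable_funX.
    exact: (measurable_innovation X (Y := cst (theta t w))).
  + by move=> w' _; rewrite lee_fin sqr_ge0.
  + by rewrite lee_fin weight_ge0.
  apply: (@le_trans _ _ ((weight t w)%:E * (c * expR (lam * enorm (theta t w)))%:E)%E).
    by rewrite lee_wpmul2l ?lee_fin ?weight_ge0//; exact: (moment_growth_copy iidV t (theta t w) j Xgrowth).
  by rewrite -EFinM lee_fin mulrCA -expRD addNr expR0 mulr1.
Qed.

Let weighted_energy t := (\int[P]_w (v t w ord0 j * weight t w)%:E)%E.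

Let weighted_energy_step t : (weighted_energy t.+1 <=
  (expR (lam * (d%:R * dirbound a b) * gamma t.+1))%:E *
  (b%:E * weighted_energy t + ((1 - b) * c)%:E))%E.
Proof.
set E := expR _; have E0 : 0 <= E by exact: expR_ge0.
pose h w := E * (b * (v t w ord0 j * weight t w)
   + (1 - b) * (X (V t w, theta t w) ord0 j ^+ 2 * weight t w)).
have h1 w : 0 <= v t w ord0 j * weight t w by rewrite mulr_ge0.
have h2 w : 0 <= X (V t w, theta t w) ord0 j ^+ 2 * weight t w by rewrite mulr_ge0 ?sqr_ge0.
have mh1 : measurable_fun setT (fun w => v t w ord0 j * weight t w) by exact: measurable_funM.
have mh2 : measurable_fun setT (fun w => X (V t w, theta t w) ord0 j ^+ 2 * weight t w).
  by apply: measurable_funM => //; exact: measurable_funX.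
have b1' : 0 <= 1 - b by rewrite subr_ge0 ltW.
apply: (@le_trans _ _ (\int[P]_w (h w)%:E)%E).
  apply: ge0_le_integral => //.
  - by move=> w _; rewrite lee_fin mulr_ge0.
  - by apply/measurable_EFinP; exact: measurable_funM.
  - apply/measurable_EFinP; apply: measurable_funM => //.
    by apply: measurable_funD; exact: measurable_funM.
  - move=> w _; rewrite lee_fin /h; have [-> _ _] := (step t w).2 j.
    rewrite 2!(mulrA _ _ (weight t w)) -mulrDl [leRHS]mulrCA; apply: ler_wpM2l.
      by rewrite addr_ge0// mulr_ge0 ?sqr_ge0// ltW.
    have dist : enorm (theta t w) <=
        enorm (theta t.+1 w) + d%:R * dirbound a b * gamma t.+1.
      apply: le_trans (enorm_le_dist _ (theta t.+1 w)) _; rewrite lerD2l enormBC.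
      by have := theta_dist w (leqnSn t); rewrite /mass big_nat1 mulrA.
    have := ler_wpM2l lam0 dist.
    by rewrite -expRD ler_expR mulrDr mulrA; lra.
have bh1 : measurable_fun setT (fun w => b * (v t w ord0 j * weight t w)).
  exact: measurable_funM.
have bh2 : measurable_fun setT
    (fun w => (1 - b) * (X (V t w, theta t w) ord0 j ^+ 2 * weight t w)).
  exact: measurable_funM.
rewrite /h ge0_integral_scale//; last 2 first.
- exact: measurable_funD.
- by move=> w; rewrite addr_ge0// mulr_ge0// ltW.
rewrite lee_wpmul2l ?lee_fin//.
rewrite ge0_integral_add//; last 2 first.
- by move=> w; rewrite mulr_ge0// ltW.
- by move=> w; rewrite mulr_ge0.
rewrite ge0_integral_scale ?(ltW b0)// leeD2l// ge0_integral_scale//.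
by rewrite EFinM lee_wpmul2l.
Qed.

(** The step sizes tend to [0], so that the contraction by [b] eventually beats
the growth of the weight between two consecutive times. *)
Lemma weighted_energy_bounded : exists (W : R) (t0 : nat), 0 <= W /\
  forall t, (t0 <= t)%N -> (\int[P]_w (v t w ord0 j * weight t w)%:E <= W%:E)%E.
Proof.
have fin t : exists2 B : R, 0 <= B & (weighted_energy t <= B%:E)%E.
  elim: t => [|t [B B0 IB]].
    exists 0 => //; rewrite /weighted_energy.
    under eq_integral => w _ do (have [_ _ ->] := init w; rewrite mxE mul0r).
    by rewrite integral_cst_probability.
  exists (expR (lam * (d%:R * dirbound a b) * gamma t.+1) * (b * B + (1 - b) * c)).
    have b1' : 0 <= 1 - b by rewrite subr_ge0 ltW.
    by rewrite mulr_ge0 ?expR_ge0// addr_ge0// mulr_ge0// ltW.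
  apply: le_trans (weighted_energy_step t) _.
  rewrite [leRHS]EFinM lee_wpmul2l ?lee_fin ?expR_ge0// EFinD leeD2r//.
  by rewrite [leRHS]EFinM lee_wpmul2l// lee_fin ltW.
have : \forall t \near \oo, expR (lam * (d%:R * dirbound a b) * gamma t) <= 1 + (1 - b) / 2.
  have : expR (lam * (d%:R * dirbound a b) * gamma t) @[t --> \oo] --> expR 0.
    apply: continuous_cvg; first exact: continuous_expR.
    rewrite -[X in _ --> X](mulr0 (lam * (d%:R * dirbound a b))).
    by apply: cvgM; [exact: cvg_cst|exact: gamma_cvg0].
  rewrite expR0 => /cvgr_le; apply; have := b1; lra.
move=> [t0 _ Ht0]; have [B B0 IB] := fin t0.
exists (B + 4 * c), t0; split; first by rewrite addr_ge0// mulr_ge0.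
move=> t; rewrite -/(weighted_energy t); elim: t => [|t ih].
  by rewrite leqn0 => /eqP t00; rewrite t00 in IB; apply: le_trans IB _; rewrite lee_fin lerDl mulr_ge0.
rewrite leq_eqVlt => /predU1P[<-|t0t]; first by apply: le_trans IB _; rewrite lee_fin lerDl mulr_ge0.
apply: le_trans (weighted_energy_step t) _.
have := Ht0 t.+1 (ltnW t0t).
set E := expR _; have E0 : 0 <= E by exact: expR_ge0.
move=> /= E1.
apply: (@le_trans _ _ (E%:E * (b%:E * (B + 4 * c)%:E + ((1 - b) * c)%:E))%E).
  rewrite lee_wpmul2l ?lee_fin// leeD2r// lee_wpmul2l// ?lee_fin ?(ltW b0)//.
  exact: ih.
rewrite -(EFinM b) -EFinD -EFinM lee_fin.
apply: (@le_trans _ _ ((1 + (1 - b) / 2) * (b * (B + 4 * c) + (1 - b) * c))).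
  rewrite ler_wpM2r// addr_ge0// mulr_ge0 ?(ltW b0) ?subr_ge0 ?(ltW b1)//.
  by rewrite addr_ge0// mulr_ge0.
have h1 : 0 <= (1 - b) * B by rewrite mulr_ge0// subr_ge0 ltW.
have h2 : 0 <= (1 - b) * c by rewrite mulr_ge0// subr_ge0 ltW.
have h3 : 0 <= (1 - b) * ((1 - b) * B) by rewrite mulr_ge0// subr_ge0 ltW.
have h4 : 0 <= (1 - b) * ((1 - b) * c) by rewrite mulr_ge0// subr_ge0 ltW.
lra.
Qed.

End weighted_energy.

Section window.
Variables (c lam r K : R) (j : 'I_d) (f : 'rV[R]_d -> 'rV[R]_d).
Hypothesis f_adam : adam_vector_field X U a b e f.
Hypotheses (lam0 : 0 <= lam) (c0 : 0 <= c) (Xgrowth : moment_growth X U c lam).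
Hypotheses (r0 : 0 <= r) (K0 : 0 <= K) (Xlip : mean_lipschitz X U (r + 1) K).
Variables (W : R) (t0 : nat).
Hypotheses (W0 : 0 <= W) (weighted : forall t, (t0 <= t)%N ->
  (\int[P]_w (v t w ord0 j * weight lam t w)%:E <= W%:E)%E).

Let kappa := dirbound a b.
Let kappa0 : 0 <= kappa. Proof. by rewrite ltW// dirbound_gt0. Qed.
Let speed := d%:R * kappa.
Let speed0 : 0 <= speed. Proof. exact: mulr_ge0. Qed.

Section fixed_window.
Variables (n l : nat).

(** Indicator of the event that the process is in the ball of radius [r] at the
beginning of the window. *)
Definition inside w : R := (enorm (theta n w) <= r)%R%:R.

(* The last [l] innovations known after step [t], from the most recent one. *)
Let backs t (i : 'I_l) : nat := (t - i)%N.

(* The direction of step [t] frozen at the parameter [theta n], and the actual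
one. *)
Let fixed t w := frozen X a b e j (theta n w, block V (backs t) w).
Let actual t w := direction a b e t.+1 (innovations t.+1 j w).

Let inside01 w : inside w = 1 /\ enorm (theta n w) <= r \/ inside w = 0.
Proof. by rewrite /inside; case: (enorm _ <= r) => /=; [left|right]. Qed.

Let measurable_inside k : (n <= k)%N -> measurable_fun setT (inside : past V k -> R).
Proof.
move=> nk; have mth := measurable_theta_past nk.
rewrite /inside; apply: (measurableT_comp (f := fun x : bool => x%:R : R)) => //.
by apply: measurable_fun_ler => //; exact: measurable_fun_enorm.
Qed.

Let theta_near t w : (n <= t)%N -> inside w = 1 -> speed * mass n t <= 1 ->
  enorm (theta t w) <= r + 1.
Proof.
move=> nt iw st; case: (inside01 w) => [[_ tr]|]; last by rewrite iw => /eqP; rewrite oner_eq0.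
apply: le_trans (enorm_le_dist _ (theta n w)) _; apply: lerD => //.
by apply: le_trans (theta_dist _ nt) _; rewrite mulrA.
Qed.

Let freezing_innovation t i : (n + l <= t)%N -> (i < l)%N ->
  speed * mass n t.+1 <= 1 ->
  (\int[P]_w ((inside w * (innovations t.+1 j w i
      - X (V (t - i) w, theta n w) ord0 j)) ^+ 2)%:E <=
    (K * (speed * mass n t.+1) ^+ 2)%:E)%E.
Proof.
move=> nlt il st.
have nti := window_sub nlt il.
have mth := measurable_theta_past (leqnn (t - i)).
have mthn := measurable_theta_past nti.
pose g (y : past V (t - i) * S) := (inside y.1 * (X (y.2, theta (t - i)%N y.1) ord0 j
      - X (y.2, theta n y.1) ord0 j)) ^+ 2.
rewrite /innovations subSS.
apply: (fresh_integral_le indV (g := g)).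
- apply: measurable_funX; apply: measurable_funM.
    exact: (measurableT_comp (measurable_inside nti)).
  by apply: measurable_funB; apply: (measurable_innovation X (V := snd)) => //;
    [exact: (measurableT_comp mth)|exact: (measurableT_comp mthn)].
- by move=> y; exact: sqr_ge0.
- move=> w; rewrite /g/=; case: (inside01 w) => [[iw tr]|iw]; last first.
    under eq_integral do rewrite iw mul0r expr0n/=.
    by rewrite integral_cst_probability lee_fin mulr_ge0 ?sqr_ge0.
  under eq_integral do rewrite iw mul1r.
  have sti : speed * mass n (t - i) <= 1.
    by apply: le_trans st; rewrite ler_wpM2l// mass_le// ltnW// ltnS leq_subr.
  have tr1 : enorm (theta n w) <= r + 1 by apply: le_trans tr _; rewrite lerDl.
  apply: le_trans (mean_lipschitz_copy iidV (t - i) j Xlip (theta_near nti iw sti) tr1) _.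
  rewrite lee_fin ler_wpM2l// ler_pXn2r// ?nnegrE ?enorm_ge0 ?(mulr_ge0 speed0 (mass_ge0 _ _))//.
  by apply: le_trans (theta_dist _ nti) _; rewrite mulrA ler_wpM2l// mass_le// ltnW// ltnS leq_subr.
Qed.

Let mactual t : measurable_fun setT (actual t).
Proof.
apply: (measurable_direction _ _ _ (x := fun i w => innovations t.+1 j w i)) => // i.
exact: mX.
Qed.

Let measurable_fixed k t : (n <= k)%N -> (t < k)%N ->
  measurable_fun setT (fixed t : past V k -> R).
Proof.
move=> nk tk; apply: (measurableT_comp (measurable_frozen X a b e0 j)).
apply: measurable_fun_pair; first exact: measurable_theta_past.
apply/measurable_fun_tnthP => i.
rewrite (_ : _ \o _ = V (backs t i)).
  by apply: measurable_past_var; apply: leq_ltn_trans tk; exact: leq_subr.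
by apply/funext => w; rewrite /= tnth_mktuple.
Qed.

Let minside : measurable_fun setT inside.
Proof. exact: (measurable_past (measurable_inside (leqnn n))). Qed.

Let mfixed t : measurable_fun setT (fixed t).
Proof.
apply: (measurable_past (V := V) (n := maxn n t.+1)); apply: measurable_fixed.
- exact: leq_maxl.
- exact: leq_maxr.
Qed.

(** Mean square error made by freezing the parameter at the beginning of the
window and by forgetting all but the last [l] innovations. *)
Let freezing t : (n + l <= t)%N -> (t0 <= t.+1 - l)%N -> speed * mass n t.+1 <= 1 ->
  (\int[P]_w ((inside w * (actual t w - fixed t w)) ^+ 2)%:E <=
   (dirlip a b e ^+ 2 * (K * (speed * mass n t.+1) ^+ 2
     + b ^+ l * (expR (lam * (r + 1)) * W)))%:E)%E.
Proof.
move=> nlt t0t st.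
pose t' := (t.+1 - l)%N.
pose y w i := X (V (t - i) w, theta n w) ord0 j.
pose z i w := inside w * (innovations t.+1 j w i - y w i).
pose h w := dirlip a b e ^+ 2 * (energy b l (z ^~ w)
  + b ^+ l * (expR (lam * (r + 1)) * (v t' w ord0 j * weight lam t' w))).
have vw0 w : 0 <= v t' w ord0 j * weight lam t' w by rewrite mulr_ge0 ?expR_ge0.
have mz i : measurable_fun setT (z i).
  apply: measurable_funM => //; apply: measurable_funB; first exact: mX.
  by apply: (measurable_innovation X (V := V (t - i))) => //; exact: measurable_theta.
have me : measurable_fun setT (fun w => energy b l (z ^~ w)) by exact: measurable_energy.
have mw : measurable_fun setT (fun w => v t' w ord0 j * weight lam t' w).
  by apply: measurable_funM => //; exact: measurable_weight.
have bl0 : 0 <= b ^+ l by rewrite exprn_ge0// ltW.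
apply: (@le_trans _ _ (\int[P]_w (h w)%:E)%E).
  apply: ge0_integral_mono => [|||w].
  - by apply: measurable_funX; apply: measurable_funM => //; exact: measurable_funB.
  - apply: measurable_funM => //; apply: measurable_funD => //.
    by apply: measurable_funM => //; exact: measurable_funM.
  - by move=> w; exact: sqr_ge0.
  case: (inside01 w) => [[iw tr]|iw]; last first.
    rewrite iw mul0r expr0n/= mulr_ge0 ?sqr_ge0// addr_ge0 ?(energy_ge0 b01)//.
    by rewrite !mulr_ge0 ?expR_ge0.
  rewrite iw mul1r /h.
  have -> : z ^~ w = fun i => innovations t.+1 j w i - y w i.
    by apply/funext => i; rewrite /z iw mul1r.
  rewrite /fixed (frozen_block a b e (x := y w)); last by [].
  have lt1 : (l <= t.+1)%N by exact: leq_trans (leq_addl n l) (leqW nlt).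
  have tE : t.+1 = (l + t')%N by rewrite subnKC.
  rewrite /actual [in leLHS]tE.
  apply: le_trans (direction_truncation e0 a01 b01 l t' _ _) _.
  rewrite -tE ler_wpM2l ?sqr_ge0// lerD2l ler_wpM2l//.
  have -> : (fun i => innovations t.+1 j w (l + i)) = innovations t' j w.
    by apply/funext => i; rewrite /innovations -addnS subnDA.
  rewrite -adam_energy mulrCA ler_peMr//.
  rewrite -expRD -[leLHS]expR0 ler_expR subr_ge0 ler_wpM2l//.
  apply: theta_near => //; first exact: window_start.
  by apply: le_trans st; rewrite ler_wpM2l// mass_le// leq_subr.
rewrite /h ge0_integral_scale ?sqr_ge0//; last 2 first.
- apply: measurable_funD => //; apply: measurable_funM => //; exact: measurable_funM.
- by move=> w; rewrite addr_ge0 ?(energy_ge0 b01)// !mulr_ge0 ?expR_ge0.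
rewrite [leRHS]EFinM lee_wpmul2l ?lee_fin ?sqr_ge0//.
rewrite ge0_integral_add//; last 3 first.
- by apply: measurable_funM => //; exact: measurable_funM.
- by move=> w; exact: (energy_ge0 b01).
- by move=> w; rewrite !mulr_ge0 ?expR_ge0.
rewrite EFinD leeD//.
  apply: (integral_energy_le b0 b1) => [|i _|i il].
  - by rewrite mulr_ge0 ?sqr_ge0.
  - exact: mz.
  - exact: freezing_innovation.
rewrite ge0_integral_scale//; last 2 first.
- exact: measurable_funM.
- by move=> w; rewrite mulr_ge0 ?expR_ge0.
rewrite ge0_integral_scale ?expR_ge0// 2!EFinM.
by rewrite lee_wpmul2l ?lee_fin// lee_wpmul2l ?lee_fin ?expR_ge0// weighted.
Qed.

(* Deviation of the frozen direction from the vector field at [theta n], which is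
close to its mean. *)
Let gap t w := fixed t w - f (theta n w) ord0 j.

Let mfield k : (n <= k)%N ->
  measurable_fun setT (fun w : past V k => f (theta n w) ord0 j).
Proof.
move=> nk; apply: (measurableT_comp (measurable_field e0 a01 b01 f_adam Xgrowth j)).
exact: measurable_theta_past.
Qed.

Let measurable_gap k t : (n <= k)%N -> (t < k)%N ->
  measurable_fun setT (gap t : past V k -> R).
Proof.
by move=> nk tk; apply: measurable_funB; [exact: measurable_fixed|exact: mfield].
Qed.

Let mgap t : measurable_fun setT (gap t).
Proof.
apply: (measurable_past (V := V) (n := maxn n t.+1)); apply: measurable_gap.
- exact: leq_maxl.
- exact: leq_maxr.
Qed.

Let gap_bound t w : `|gap t w| <= 2 * kappa.
Proof.
apply: le_trans (ler_normB _ _) _; rewrite mulr_natl mulr2n.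
apply: lerD; first exact: frozen_bound.
exact: (field_bound e0 a01 b01 f_adam Xgrowth).
Qed.

Let inside_norm w : `|inside w| <= 1.
Proof. by case: (inside01 w) => [[-> _]|->]; rewrite ?normr1 ?normr0. Qed.

(* The first [l] times of the window are left out, since the last [l] innovations
have to be independent of [theta n]. *)
Let fluctuation_term t w : R :=
  if (n + l <= t)%N then gamma t.+1 * (inside w * gap t w) else 0.

Let fluctuation k w := \sum_(n <= t < k) fluctuation_term t w.

Let term_bound t w : `|fluctuation_term t w| <= gamma t.+1 * (2 * kappa).
Proof.
have g0 : 0 < gamma t.+1 by exact: gamma_gt0.
have k2 : 0 <= 2 * kappa by rewrite (mulr_ge0 _ kappa0).
rewrite /fluctuation_term; case: ifP => _; last by rewrite normr0 (mulr_ge0 (ltW g0)).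
rewrite normrM gtr0_norm// ler_pM2l// normrM -[leRHS]mul1r.
by apply: ler_pM.
Qed.

Let fluctuation_bound k w : `|fluctuation k w| <= 2 * kappa * mass n k.
Proof.
apply: le_trans (ler_norm_sum _ _ _) _; rewrite /mass mulr_sumr.
by apply: ler_sum => t _; rewrite mulrC; exact: term_bound.
Qed.

Let measurable_term k t : (n <= k)%N -> (t < k)%N ->
  measurable_fun setT (fluctuation_term t : past V k -> R).
Proof.
move=> nk tk; rewrite /fluctuation_term; case: (n + l <= t)%N => //.
apply: measurable_funM => //; apply: measurable_funM.
  exact: measurable_inside.
exact: measurable_gap.
Qed.

Let measurable_fluctuation k k' : (n <= k')%N -> (k <= k')%N ->
  measurable_fun setT (fluctuation k : past V k' -> R).
Proof.
move=> nk' kk'; rewrite /fluctuation.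
rewrite (_ : (fun w => _) = fun w => \sum_(t < k - n)
    fluctuation_term (t + n)%N w); last first.
  apply/funext => w; rewrite -{1}[n]add0n big_addn big_mkord.
  by [].
apply: measurable_sum => t; apply: measurable_term => //.
by apply: leq_trans kk'; apply: window_shift; exact: ltn_ord.
Qed.

Let mfluctuation k : measurable_fun setT (fluctuation k).
Proof.
apply: (measurable_past (V := V) (n := maxn n k)); apply: measurable_fluctuation.
- exact: leq_maxl.
- exact: leq_maxr.
Qed.

Let inside_fluctuation k w : inside w * fluctuation k w = fluctuation k w.
Proof.
rewrite /fluctuation mulr_sumr; apply: eq_bigr => t _; rewrite /fluctuation_term.
case: ifP => _; last by rewrite mulr0.
by case: (inside01 w) => [[-> _]|->]; rewrite ?mul1r// !mul0r mulr0.
Qed.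

Variable eps : R.
Hypotheses (eps0 : 0 <= eps)
  (eps_ge : dirlip a b e ^+ 2 * (b ^+ l * (c * expR (lam * r))) <= eps ^+ 2).

Let gap_mean t w : (n + l <= t)%N -> enorm (theta n w) <= r ->
  `|\int[P]_w' (frozen X a b e j (theta n w, block V (backs t) w')
                - f (theta n w) ord0 j)| <= eps.
Proof.
move=> nlt tr.
have backs_inj : injective (backs t).
  by move=> i i' bi; apply: ord_inj; exact: (window_inj nlt (ltn_ord i) (ltn_ord i') bi).
have mF : measurable_fun setT (fun w' => frozen X a b e j (theta n w, block V (backs t) w')).
  apply: (measurableT_comp (measurable_frozen X a b e0 j)).
  by apply: measurable_fun_pair => //; exact: measurable_block.
have bF w' : `|frozen X a b e j (theta n w, block V (backs t) w')| <= dirbound a b.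
  exact: frozen_bound.
rewrite RintegralB//; [|exact: (bounded_integrable _ mF bF)|exact: finite_measure_integrable_cst].
rewrite [X in _ - X](_ : _ = f (theta n w) ord0 j); last first.
  by rewrite /Rintegral integral_cst_probability.
rewrite -(ler_pXn2r (n := 2)) ?nnegrE// real_normK ?num_real//.
apply: le_trans (frozen_mean_dist e0 a01 b01 f_adam Xgrowth (theta n w) j iidV backs_inj) _.
apply: le_trans eps_ge; rewrite ler_wpM2l ?sqr_ge0// ler_wpM2l ?exprn_ge0 ?(ltW b0)//.
by rewrite ler_wpM2l// ler_expR ler_wpM2l.
Qed.

(* Given what is known at time [k - l], the deviation at time [k] is nearly
centered, up to [eps]. *)
Let cross k : (n + l <= k)%N ->
  \int[P]_w (fluctuation k w * gap k w) <=
    2 * kappa * mass n k * eps + 4 * kappa ^+ 2 * l%:R * gamma n.+1.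
Proof.
move=> nlk.
have nkl := window_before nlk.
have klk : (k - l <= k)%N by exact: leq_subr.
have k2 : 0 <= 2 * kappa by rewrite (mulr_ge0 _ kappa0).
(* The sum up to time [k - l] is known before the innovations that enter the
frozen direction at time [k]; the [l] remaining terms are small. *)
pose rest w := \sum_(k - l <= t < k) fluctuation_term t w.
have splitE w : fluctuation k w = fluctuation (k - l) w + rest w.
  by rewrite /fluctuation (big_cat_nat nkl klk).
have restb w : `|rest w| <= l%:R * (gamma n.+1 * (2 * kappa)).
  apply: le_trans (ler_norm_sum _ _ _) _.
  apply: (@le_trans _ _ (\sum_(k - l <= t < k) (gamma n.+1 * (2 * kappa)))).
    rewrite big_nat [leRHS]big_nat; apply: ler_sum => t /andP[klt tk].
    apply: le_trans (term_bound t w) _; rewrite ler_wpM2r//.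
    by apply: gamma_decr => //; rewrite ltnS (leq_trans nkl).
  by rewrite sumr_const_nat (subKn (leq_trans (leq_addl n l) nlk)) -[leLHS]mulr_natl.
have mrest : measurable_fun setT rest.
  rewrite (_ : rest = fun w => fluctuation k w - fluctuation (k - l) w); last first.
    by apply/funext => w; rewrite splitE addrAC subrr add0r.
  exact: measurable_funB.
have b1w w : `|fluctuation (k - l) w * gap k w| <= (2 * kappa * mass n (k - l)) * (2 * kappa).
  by rewrite normrM; apply: ler_pM.
have b2w w : `|rest w * gap k w| <= l%:R * (gamma n.+1 * (2 * kappa)) * (2 * kappa).
  by rewrite normrM; apply: ler_pM.
have m1 : measurable_fun setT (fun w => fluctuation (k - l) w * gap k w) by exact: measurable_funM.
have m2 : measurable_fun setT (fun w => rest w * gap k w) by exact: measurable_funM.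
have i1 := bounded_integrable P m1 b1w.
have i2 := bounded_integrable P m2 b2w.
rewrite (_ : \int[P]_w (fluctuation k w * gap k w) =
    \int[P]_w (fluctuation (k - l) w * gap k w) + \int[P]_w (rest w * gap k w)); last first.
  by rewrite -RintegralD//; apply: eq_Rintegral => w _; rewrite splitE mulrDl.
apply: lerD; last first.
  apply: (@le_trans _ _ (\int[P]_w (l%:R * (gamma n.+1 * (2 * kappa)) * (2 * kappa)))).
    apply: le_Rintegral => //; first exact: finite_measure_integrable_cst.
    by move=> w _; apply: le_trans (ler_norm _) (b2w w).
  rewrite /Rintegral integral_cst_probability/=.
  by rewrite le_eqVlt; apply/orP; left; apply/eqP; ring.
apply: le_trans (ler_norm _) _.
have mth := measurable_theta_past nkl.
have mf' := mfield nkl.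
apply: (fresh_Rintegral_le indV (n := (k - l)%N) (s := backs k)
  (Y := fluctuation (k - l)%N)
  (g := fun y => frozen X a b e j (theta n y.1, y.2) - f (theta n y.1) ord0 j)
  (c := 2 * kappa * mass n (k - l)) (k := 2 * kappa)).
- by move=> i; apply: leq_sub2l; exact: ltnW.
- exact: measurable_fluctuation.
- apply: measurable_funB; last exact: (measurableT_comp mf').
  apply: (measurableT_comp (measurable_frozen X a b e0 j)).
  by apply: measurable_fun_pair => //; exact: (measurableT_comp mth).
- exact: fluctuation_bound.
- move=> y; apply: le_trans (ler_normB _ _) _; rewrite mulr_natl mulr2n.
  apply: lerD; first exact: frozen_bound.
  exact: (field_bound e0 a01 b01 f_adam Xgrowth).
- move=> w; case: (inside01 w) => [[_ tr]|iw]; last first.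
    by rewrite -inside_fluctuation iw !mul0r normr0 (mulr_ge0 (mulr_ge0 k2 (mass_ge0 _ _)) eps0).
  rewrite normrM; apply: ler_pM => //; last exact: gap_mean.
  apply: le_trans (fluctuation_bound _ _) _.
  by rewrite (ler_wpM2l k2)// mass_le.
Qed.

(* Induction on the end of the window, with [cross] for the mixed term. *)
Let fluctuation_L2 k eta : mass n k <= eta ->
  \int[P]_w (fluctuation k w ^+ 2) <= mass n k *
    (4 * kappa * eta * eps + (8 * l%:R + 4) * kappa ^+ 2 * gamma n.+1).
Proof.
set B := 4 * kappa * eta * eps + _.
have k2 : 0 <= 2 * kappa by rewrite (mulr_ge0 _ kappa0).
have gn0 : 0 < gamma n.+1 by exact: gamma_gt0.
elim: k => [|k ih] meta.
  by rewrite /mass big_geq// mul0r; under eq_Rintegral do rewrite /fluctuation big_geq// expr0n/=;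
    rewrite /Rintegral integral_cst_probability.
have mk := mass_le n (leqnSn k).
have eta0 : 0 <= eta := le_trans (mass_ge0 _ _) meta.
have {}ih := ih (le_trans mk meta).
have B0 : 0 <= B.
  rewrite /B; apply: addr_ge0.
    by rewrite (mulr_ge0 _ eps0)// (mulr_ge0 _ eta0)// (mulr_ge0 _ kappa0).
  have h8 : 0 <= 8 * l%:R + 4 :> R by rewrite addr_ge0// mulr_ge0.
  exact: mulr_ge0 (mulr_ge0 h8 (sqr_ge0 _)) (ltW gn0).
have [nlk|kln] := leqP (n + l) k; last first.
  have nomass : fluctuation k.+1 = fun=> 0.
    apply/funext => w; rewrite /fluctuation big_nat big1// => t /andP[nt tk].
    by rewrite /fluctuation_term leqNgt (leq_trans _ kln).
  by rewrite nomass; under eq_Rintegral do rewrite expr0n/=;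
    rewrite /Rintegral integral_cst_probability mulr_ge0// mass_ge0.
have nk : (n <= k)%N := leq_trans (leq_addr l n) nlk.
have massS : mass n k.+1 = mass n k + gamma k.+1 by rewrite /mass big_nat_recr.
have gk0 : 0 < gamma k.+1 by exact: gamma_gt0.
have gkn : gamma k.+1 <= gamma n.+1 by apply: gamma_decr.
have mF := mfluctuation k.
have bF := fluctuation_bound k.
have msq : measurable_fun setT (fun w => fluctuation k w ^+ 2) by exact: measurable_funX.
have bsq w : `|fluctuation k w ^+ 2| <= (2 * kappa * mass n k) ^+ 2.
  by rewrite normrX ler_pXn2r// nnegrE (mulr_ge0 k2 (mass_ge0 _ _)).
have mcr : measurable_fun setT (fun w => fluctuation k w * gap k w) by exact: measurable_funM.
have bcr w : `|fluctuation k w * gap k w| <= (2 * kappa * mass n k) * (2 * kappa).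
  by rewrite normrM; apply: ler_pM.
have isq := bounded_integrable P msq bsq.
have icr := bounded_integrable P mcr bcr.
have iZ : P.-integrable setT (EFin \o (fun w => 2 * gamma k.+1 * (fluctuation k w * gap k w))).
  by rewrite /comp; under eq_fun do rewrite EFinM; exact: integrableZl.
have iS : P.-integrable setT (EFin \o (fun w => fluctuation k w ^+ 2 +
    2 * gamma k.+1 * (fluctuation k w * gap k w))).
  by rewrite /comp; under eq_fun do rewrite EFinD; exact: (integrableD _ isq iZ).
have icst : P.-integrable setT (EFin \o (cst (4 * kappa ^+ 2 * gamma k.+1 ^+ 2))).
  exact: finite_measure_integrable_cst.
apply: (@le_trans _ _ (\int[P]_w (fluctuation k w ^+ 2 +
    2 * gamma k.+1 * (fluctuation k w * gap k w) + 4 * kappa ^+ 2 * gamma k.+1 ^+ 2))).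
  apply: le_Rintegral => //.
  - apply: (@bounded_integrable _ _ _ P _ ((2 * kappa * mass n k.+1) ^+ 2)).
      exact: measurable_funX.
    move=> w; rewrite normrX; apply: lerXn2r; rewrite ?nnegrE//.
    exact: mulr_ge0 k2 (mass_ge0 _ _).
  - by rewrite /comp; under eq_fun do rewrite EFinD; exact: (integrableD _ iS icst).
  move=> w _; rewrite {1}/fluctuation big_nat_recr//= -/(fluctuation k w).
  rewrite /fluctuation_term nlk sqrrD; apply: lerD.
    rewrite lerD2l.
    rewrite -{1}(inside_fluctuation k w) -[leLHS]mulr_natl.
    have -> : inside w * fluctuation k w * (gamma k.+1 * (inside w * gap k w)) =
      inside w * (inside w * fluctuation k w) * (gamma k.+1 * gap k w) by ring.
    by rewrite !inside_fluctuation; rewrite le_eqVlt; apply/orP; left; apply/eqP; ring.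
  have -> : 4 * kappa ^+ 2 * gamma k.+1 ^+ 2 = (gamma k.+1 * (2 * kappa)) ^+ 2 by ring.
  have := term_bound k w; rewrite /fluctuation_term nlk => tb.
  rewrite -[leLHS]real_normK ?num_real// ler_pXn2r// ?nnegrE//.
  exact: le_trans tb.
rewrite RintegralD// RintegralD// RintegralZl//.
rewrite [X in _ + X](_ : _ = 4 * kappa ^+ 2 * gamma k.+1 ^+ 2); last first.
  by rewrite /Rintegral integral_cst_probability.
have cr := cross nlk.
have cr' : \int[P]_w (fluctuation k w * gap k w) <=
    2 * kappa * eta * eps + 4 * kappa ^+ 2 * l%:R * gamma n.+1.
  apply: le_trans cr _; rewrite lerD2r ler_wpM2r// (ler_wpM2l k2)//.
  exact: le_trans mk meta.
have g1 := ler_wpM2l (ltW (mulr_gt0 (ltr0Sn R 1) gk0)) cr'.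
have kg : kappa ^+ 2 * gamma k.+1 * gamma k.+1 <= kappa ^+ 2 * gamma k.+1 * gamma n.+1.
  by rewrite ler_wpM2l// mulr_ge0 ?sqr_ge0// ltW.
move: ih g1 kg; rewrite massS /B; set I1 := \int[P]_w _; set I2 := \int[P]_w _.
lra.
Qed.

Let sum_first (k : nat) (x : R) : 0 <= x ->
  \sum_(n <= t < k) (if (n + l <= t)%N then 0 else x) <= l%:R * x.
Proof.
move=> x0; have [kl|/ltnW lk] := leqP k (n + l).
  apply: (@le_trans _ _ (\sum_(n <= t < k) x)).
    by apply: ler_sum => t _; case: ifP.
  by rewrite sumr_const_nat -[leLHS]mulr_natl ler_wpM2r// ler_nat leq_subLR.
rewrite (big_cat_nat (leq_addr l n) lk)/= [X in _ + X]big_nat [X in _ + X]big1 ?addr0.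
  apply: (@le_trans _ _ (\sum_(n <= t < n + l) x)).
    by apply: ler_sum => t _; case: ifP.
  by rewrite sumr_const_nat -[leLHS]mulr_natl addKn.
by move=> t /andP[-> _].
Qed.

(** The four terms of the bound come from the first [l] steps, the bias correction,
the freezing of the parameter and the fluctuations of the frozen directions. *)
Lemma window_bound k eta sb sS : (n <= k)%N -> mass n k <= eta -> speed * eta <= 1 ->
  (t0 <= n)%N -> 0 <= sb -> 0 <= sS ->
  dirlip a b e ^+ 2 * (K * (speed * eta) ^+ 2
     + b ^+ l * (expR (lam * (r + 1)) * W)) <= sb ^+ 2 ->
  eta * (4 * kappa * eta * eps + (8 * l%:R + 4) * kappa ^+ 2 * gamma n.+1) <= sS ^+ 2 ->
  (\int[P]_w `|inside w * (theta k w ord0 j - theta n w ord0 j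
                 - mass n k * f (theta n w) ord0 j)|%:E <=
   (2 * kappa * l%:R * gamma n.+1 + eta * (kappa * b ^+ n) + eta * sb + sS)%:E)%E.
Proof.
move=> nk meta seta t0n sb0 sS0 sbE sSE.
have k2 : 0 <= 2 * kappa by rewrite (mulr_ge0 _ kappa0).
have gn0 : 0 < gamma n.+1 by exact: gamma_gt0.
have eta0 : 0 <= eta := le_trans (mass_ge0 n k) meta.
have bn0 : 0 <= b ^+ n by rewrite exprn_ge0// ltW.
pose u t w := if (n + l <= t)%N
  then gamma t.+1 * `|inside w * (actual t w - fixed t w)| else 0.
have u0 t w : 0 <= u t w.
  by rewrite /u; case: ifP => // _; rewrite mulr_ge0// ltW// gamma_gt0.
have mu t : measurable_fun setT (u t).
  rewrite /u; case: (n + l <= t)%N => //; apply: measurable_funM => //.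
  apply: measurableT_comp => //; apply: measurable_funM => //.
  exact: measurable_funB.
pose A := 2 * kappa * l%:R * gamma n.+1 + eta * (kappa * b ^+ n).
have A0 : 0 <= A.
  rewrite addr_ge0 ?(mulr_ge0 eta0 (mulr_ge0 kappa0 bn0))//.
  by rewrite (mulr_ge0 _ (ltW gn0))// (mulr_ge0 k2).
have msum : measurable_fun setT (fun w => \sum_(n <= t < k) u t w).
  by apply: measurable_sum.
have sum0 w : 0 <= \sum_(n <= t < k) u t w by apply: sumr_ge0.
have mfl : measurable_fun setT (fun w => `|fluctuation k w|).
  exact: measurableT_comp.
have mth := measurable_theta.
have mcoord t : measurable_fun setT (fun w => theta t w ord0 j).
  by move: j; apply/measurable_fun_rV; exact: mth.
have mf0 : measurable_fun setT (fun w => f (theta n w) ord0 j).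
  by apply: (measurable_past (V := V) (n := n)); exact: mfield.
apply: (@le_trans _ _ (\int[P]_w (A + (\sum_(n <= t < k) u t w + `|fluctuation k w|))%:E)%E).
  apply: ge0_integral_mono => //.
  - apply: measurableT_comp => //; apply: measurable_funM => //.
    by apply: measurable_funB; [exact: measurable_funB|exact: measurable_funM].
  - by apply: measurable_funD => //; exact: measurable_funD.
  move=> w; rewrite addrA.
  pose q t := inside w * (gamma t.+1 * (increment t w j - f (theta n w) ord0 j)).
  have -> : inside w * (theta k w ord0 j - theta n w ord0 j
      - mass n k * f (theta n w) ord0 j)
      = \sum_(n <= t < k) (q t - fluctuation_term t w) + fluctuation k w.
    rewrite sumrB subrK /q -mulr_sumr; congr (_ * _).
    rewrite theta_sum// /mass mulr_suml -sumrB.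
    by apply: eq_bigr => t _; rewrite mulrBr.
  apply: le_trans (ler_normD _ _) _; rewrite lerD2r.
  apply: le_trans (ler_norm_sum _ _ _) _.
  pose p t := if (n + l <= t)%N then 0 else gamma n.+1 * (2 * kappa).
  apply: (@le_trans _ _ (\sum_(n <= t < k)
      ((p t + gamma t.+1 * (kappa * b ^+ n)) + u t w))).
    rewrite big_nat [leRHS]big_nat; apply: ler_sum => t /andP[nt tk].
    have gt0 : 0 < gamma t.+1 by exact: gamma_gt0.
    have gtn : gamma t.+1 <= gamma n.+1 by apply: gamma_decr.
    have kb0 : 0 <= gamma t.+1 * (kappa * b ^+ n).
      exact: mulr_ge0 (ltW gt0) (mulr_ge0 kappa0 bn0).
    rewrite /p /fluctuation_term /u; case: ifP => _; last first.
      rewrite subr0 addr0; apply: (@le_trans _ _ (gamma n.+1 * (2 * kappa))); last by rewrite lerDl.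
      rewrite /q normrM -[leRHS]mul1r; apply: ler_pM => //.
      rewrite normrM gtr0_norm//; apply: ler_pM => //; first exact: ltW.
      apply: le_trans (ler_normB _ _) _; rewrite mulr_natl mulr2n.
      apply: lerD; first exact: increment_bound.
      exact: (field_bound e0 a01 b01 f_adam Xgrowth).
    rewrite add0r.
    have -> : q t - gamma t.+1 * (inside w * gap t w) =
        inside w * (gamma t.+1 * (increment t w j - actual t w))
        + gamma t.+1 * (inside w * (actual t w - fixed t w)).
      by rewrite /q /gap; ring.
    apply: le_trans (ler_normD _ _) _; apply: lerD; last first.
      by rewrite normrM gtr0_norm.
    rewrite normrM -[leRHS]mul1r; apply: ler_pM => //.
    rewrite normrM gtr0_norm//; apply: ler_pM => //; first exact: ltW.
    apply: le_trans (increment_direction t w j) _.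
    rewrite (ler_wpM2l kappa0)// ler_wiXn2l ?(ltW b0) ?(ltW b1)//.
    exact: leq_trans nt (leqnSn t).
  rewrite big_split/= lerD2r big_split/=; apply: lerD.
    apply: le_trans (sum_first _ _) _; first by rewrite (mulr_ge0 (ltW gn0) k2).
    by rewrite le_eqVlt; apply/orP; left; apply/eqP; ring.
  rewrite -mulr_suml ler_wpM2r//; exact: mulr_ge0 kappa0 bn0.
rewrite ge0_integral_add//; last 2 first.
- exact: measurable_funD.
- by move=> w; rewrite addr_ge0.
rewrite integral_cst_probability -[leRHS]/((A + eta * sb + sS)%:E) -addrA.
rewrite [leRHS]EFinD; apply: leeD => //.
rewrite ge0_integral_add// [leRHS]EFinD; apply: leeD.
  under eq_integral do rewrite -sumEFin.
  rewrite ge0_integral_sum//; last 2 first.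
  - by move=> t; exact/measurable_EFinP.
  - by move=> t w _; rewrite lee_fin.
  apply: (@le_trans _ _ (\sum_(n <= t < k) (gamma t.+1 * sb)%:E)%E); last first.
    by rewrite sumEFin lee_fin -mulr_suml ler_wpM2r.
  rewrite big_nat_cond [leRHS]big_nat_cond; apply: lee_sum => t /andP[/andP[nt tk] _].
  have gt0 : 0 <= gamma t.+1 by rewrite ltW// gamma_gt0.
  rewrite /u; have [nlt|_] := boolP (n + l <= t)%N; last first.
    by rewrite integral0_eq// lee_fin mulr_ge0.
  have mnt : mass n t.+1 <= eta by apply: le_trans meta; exact: mass_le.
  have mdiff : measurable_fun setT (fun w => inside w * (actual t w - fixed t w)).
    by apply: measurable_funM => //; exact: measurable_funB.
  have bdiff w : `|inside w * (actual t w - fixed t w)| <= 1 * (kappa + kappa).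
    rewrite normrM; apply: ler_pM => //.
    apply: le_trans (ler_normB _ _) _; apply: lerD; first exact: direction_bound.
    exact: frozen_bound.
  rewrite ge0_integral_scale//; last exact: measurableT_comp.
  rewrite EFinM lee_wpmul2l ?lee_fin//.
  apply: (integral_norm_le_sqrt mdiff bdiff sb0).
  have st : speed * mass n t.+1 <= 1 by apply: le_trans seta; rewrite ler_wpM2l.
  have t0t : (t0 <= t.+1 - l)%N := leq_trans t0n (window_start nlt).
  apply: le_trans (freezing nlt t0t st) _; rewrite lee_fin.
  apply: le_trans sbE; rewrite ler_wpM2l ?sqr_ge0// lerD2r ler_wpM2l//.
  apply: lerXn2r; rewrite ?nnegrE.
  - exact: mulr_ge0 speed0 (mass_ge0 _ _).
  - exact: mulr_ge0 speed0 eta0.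
  - by rewrite ler_wpM2l.
apply: (integral_norm_le_sqrt (mfluctuation k) (fluctuation_bound k) sS0).
have msq : measurable_fun setT (fun w => fluctuation k w ^+ 2) by exact: measurable_funX.
have bsq w : `|fluctuation k w ^+ 2| <= (2 * kappa * mass n k) ^+ 2.
  rewrite normrX; apply: lerXn2r; rewrite ?nnegrE//.
  exact: mulr_ge0 k2 (mass_ge0 _ _).
rewrite (bounded_integralE P msq bsq) lee_fin.
apply: le_trans (fluctuation_L2 meta) _; apply: le_trans sSE.
rewrite ler_wpM2r//.
have h8 : 0 <= 8 * l%:R + 4 :> R by rewrite addr_ge0// mulr_ge0.
apply: addr_ge0; last exact: mulr_ge0 (mulr_ge0 h8 (sqr_ge0 _)) (ltW gn0).
by rewrite (mulr_ge0 _ eps0)// (mulr_ge0 _ eta0)// (mulr_ge0 _ kappa0).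
Qed.

End fixed_window.

(** On a late window of mass at most [eta], the process moves by that mass times the
vector field, up to a mean error that is small compared with [eta]. *)
Lemma window_dist tol : 0 < tol -> exists2 eta0 : R, 0 < eta0 &
  forall eta, 0 < eta -> eta <= eta0 -> exists n0 : nat, forall n k,
  (n0 <= n)%N -> (n <= k)%N -> mass n k <= eta ->
  (\int[P]_w `|inside n w * (theta k w ord0 j - theta n w ord0 j
                 - mass n k * f (theta n w) ord0 j)|%:E <= (tol * eta)%:E)%E.
Proof.
move=> tol0.
have kp : 0 < kappa by exact: dirbound_gt0.
pose M := dirlip a b e ^+ 2 * K * speed ^+ 2.
have M0 : 0 <= M by rewrite (mulr_ge0 _ (sqr_ge0 _))// mulr_ge0 ?sqr_ge0.
have M1 : 0 < M + 1 by rewrite ltr_wpDl.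
have s1 : 0 < speed + 1 by rewrite ltr_wpDl.
(* The first bound keeps the process within distance [1] during the window, the
second one makes the error due to the motion during the window small. *)
exists (Num.min (speed + 1)^-1 (tol / (6 * (M + 1)))).
  by rewrite lt_min invr_gt0 s1 divr_gt0// mulr_gt0.
move=> eta eta0; rewrite le_min => /andP[eta1 eta2].
have seta : speed * eta <= 1.
  have : eta * (speed + 1) <= 1 by rewrite -ler_pdivlMr// div1r.
  by rewrite mulrDr mulr1 mulrC; lra.
have Meta : M * eta ^+ 2 <= tol ^+ 2 / 32.
  have h : eta * (6 * (M + 1)) <= tol by rewrite -ler_pdivlMr// mulr_gt0.
  have h2 : (eta * (6 * (M + 1))) ^+ 2 <= tol ^+ 2.
    by apply: lerXn2r; rewrite ?nnegrE ?(ltW tol0)// !mulr_ge0 ?(ltW eta0) ?(ltW M1).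
  have h3 : 0 <= M * eta ^+ 2 by rewrite mulr_ge0 ?sqr_ge0.
  have h4 : 0 <= (M * eta) ^+ 2 by exact: sqr_ge0.
  have h5 := sqr_ge0 eta.
  have : (eta * (6 * (M + 1))) ^+ 2 = 36 * (M * eta) ^+ 2 + 72 * (M * eta ^+ 2) + 36 * eta ^+ 2.
    by ring.
  lra.
pose eps := tol ^+ 2 / (128 * kappa).
have eps0 : 0 < eps by rewrite divr_gt0 ?exprn_gt0// (mulr_gt0 _ kp).
have bcvg : (fun n => b ^+ n) @ \oo --> (0 : R).
  by apply: cvg_expr; rewrite ger0_norm// ltW.
have [l1 Hl1] := small_eventually
  (dirlip a b e ^+ 2 * (expR (lam * (r + 1)) * W)) bcvg (e := tol ^+ 2 / 32)
  ltac:(by rewrite divr_gt0 ?exprn_gt0).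
have [l2 Hl2] := small_eventually
  (dirlip a b e ^+ 2 * (c * expR (lam * r))) bcvg (e := eps ^+ 2) ltac:(by rewrite exprn_gt0).
(* The number [l] of innovations that are kept depends on [tol] only; then [n] is
taken large. *)
pose l := maxn l1 l2.
pose L := (8 * l%:R + 4) * kappa ^+ 2.
have L0 : 0 < L.
  by rewrite mulr_gt0 ?exprn_gt0// ltr_wpDl// mulr_ge0.
have te : 0 < tol * eta by exact: mulr_gt0.
have [n1 Hn1] := small_eventually L gamma_cvg0 (e := tol ^+ 2 * eta / 32)
  ltac:(by rewrite divr_gt0 ?mulr_gt0 ?exprn_gt0).
have [n2 Hn2] := small_eventually (2 * kappa * l%:R) gamma_cvg0 (e := tol * eta / 4)
  ltac:(by rewrite divr_gt0).
have [n3 Hn3] := small_eventually kappa bcvg (e := tol / 4) ltac:(by rewrite divr_gt0).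
exists (maxn t0 (maxn n1 (maxn n2 n3))) => n k.
rewrite !geq_max => /and4P[t0n n1n n2n n3n] nk meta.
have tol4 : 0 <= tol / 4 by rewrite divr_ge0// ltW.
have sS0 : 0 <= tol * eta / 4 by rewrite divr_ge0// ltW.
have h1 : dirlip a b e ^+ 2 * (b ^+ l * (c * expR (lam * r))) <= eps ^+ 2.
  by rewrite mulrCA mulrC; apply: Hl2; exact: leq_maxr.
apply: le_trans (@window_bound n l eps (ltW eps0) h1 k eta (tol / 4) (tol * eta / 4)
  nk meta seta t0n tol4 sS0 _ _) _.
- have := Hl1 l (leq_maxl _ _); move: Meta; rewrite /M.
  set q := dirlip _ _ _ ^+ 2; set E := expR _; set bl := b ^+ l; lra.
- have := Hn1 n.+1 (leqW n1n); rewrite -/L => Hg.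
  have -> : 4 * kappa * eta * eps = tol ^+ 2 * eta / 32.
    by rewrite /eps; field; rewrite gt_eqF.
  have -> : (tol * eta / 4) ^+ 2 = eta * (tol ^+ 2 * eta / 32 + tol ^+ 2 * eta / 32).
    by field.
  by rewrite ler_wpM2l ?(ltW eta0)// lerD2l.
rewrite lee_fin.
have g1 := Hn2 n.+1 (leqW n2n).
have g2 := ler_wpM2l (ltW eta0) (Hn3 n n3n).
lra.
Qed.

End window.
End adam_process.

(** * The vector field vanishes at the limit *)

(** Since the step sizes are not summable and eventually small, every late time
begins a window whose mass is between [eta / 2] and [eta]. *)
Lemma window_exists (R : realType) (gamma : nat -> R) (n : nat) (eta : R) :
  (forall n, (1 <= n)%N -> 0 < gamma n) ->
  (forall m n, (1 <= m)%N -> (m <= n)%N -> gamma n <= gamma m) ->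
  ~ cvgn (series (fun n => gamma n.+1)) ->
  0 < eta -> gamma n.+1 <= eta / 2 ->
  exists k, [/\ (n <= k)%N, eta / 2 <= mass gamma n k & mass gamma n k <= eta].
Proof.
move=> g0 gd gns eta0 gn.
have : exists k, (n <= k)%N && (eta / 2 <= mass gamma n k).
  apply: contrapT => nok; apply: gns; apply: nondecreasing_is_cvgn.
    by apply/nondecreasing_seqP => i; rewrite /series/= big_nat_recr//= lerDl ltW// g0.
  exists (\sum_(0 <= i < n) gamma i.+1 + eta / 2) => _ [k _ <-]; rewrite /series/=.
  have [kn|/ltnW nk] := leqP k n.
    rewrite (big_cat_nat (leq0n k) kn)/= -addrA lerDl addr_ge0 ?divr_ge0// ?(ltW eta0)//.
    by apply: sumr_ge0 => i _; rewrite ltW// g0.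
  rewrite (big_cat_nat (leq0n n) nk)/= lerD2l leNgt; apply/negP => lt.
  by apply: nok; exists k; rewrite nk /mass ltW.
move=> ex; case: (ex_minnP ex) => k /andP[nk hk] kmin; exists k; split => //.
case: k nk hk kmin => [|k] nk hk kmin.
  by move: hk; rewrite /mass big_geq//; lra.
have [nk'|kn] := leqP n k; last first.
  by move: hk; rewrite /mass big_geq//; lra.
have mk : mass gamma n k < eta / 2.
  rewrite ltNge; apply/negP => hk'; have := kmin k; rewrite nk' hk' => /(_ isT).
  by rewrite ltnn.
have gk : gamma k.+1 <= gamma n.+1 by exact: gd.
by rewrite /mass big_nat_recr//= -/(mass gamma n k); lra.
Qed.

(** Markov's inequality. *)
Lemma markov_le (R : realType) d (T : measurableType d) (P : probability T R)
    (h : T -> R) (x s : R) : measurable_fun setT h -> (forall w, 0 <= h w) -> 0 < x ->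
  (\int[P]_w (h w)%:E <= (x * s)%:E)%E ->
  (P [set w | (x <= h w)%R] <= s%:E)%E.
Proof.
move=> mh h0 x0 hs.
have mA : measurable [set w | x <= h w].
  have := measurable_fun_ler (@measurable_cst _ _ T _ setT x) mh.
  by move=> /(_ measurableT [set true]); rewrite setTI; apply.
have : (\int[P]_w (x * \1_[set w | (x <= h w)%R] w)%:E <= (x * s)%:E)%E.
  apply: le_trans hs; apply: ge0_integral_mono => //.
  - by apply: measurable_funM => //; exact: measurable_indic.
  - by move=> w; rewrite mulr_ge0// ltW.
  - move=> w; rewrite indicE; case: (boolP (w \in _)) => [|_]; last by rewrite mulr0.
    by rewrite inE/= mulr1.
rewrite ge0_integral_scale ?(ltW x0)//.
by rewrite integral_indic// setIT EFinM lee_pmul2l.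
Qed.

Section final.
Context {R : realType} {dS : measure_display} {S : measurableType dS} {d : nat}
  {dO : measure_display} {Omega : measurableType dO} {P : probability Omega R}.
Variables (X : {mfun (S * 'rV[R]_d)%type >-> 'rV[R]_d}) (U : {RV P >-> S}).
Variables (a b e : R).
Hypotheses (e0 : 0 < e) (a01 : 0 <= a < 1) (b01 : a ^+ 2 < b < 1).
Variable gamma : nat -> R.
Hypotheses (gamma_gt0 : forall n, (1 <= n)%N -> 0 < gamma n)
  (gamma_nonsummable : ~ cvgn (series (fun n => gamma n.+1)))
  (gamma_decr : forall m n, (1 <= m)%N -> (m <= n)%N -> gamma n <= gamma m)
  (gamma_cvg0 : gamma @ \oo --> (0 : R)).
Variables (p : R) (hp : 2 <= p) (XU : locally_regular p X U).
Variables (vartheta : 'rV[R]_d) (theta : nat -> Omega -> 'rV[R]_d).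
Hypothesis theta_adam : adam_algorithm X U gamma a b e vartheta theta.
Variable f : 'rV[R]_d -> 'rV[R]_d.
Hypothesis f_adam : adam_vector_field X U a b e f.
Variables (theta_oo : {RV P >-> 'rV[R]_d}) (Omega0 : set Omega).
Hypothesis mOmega0 : measurable Omega0.
Hypothesis theta_cvg : forall s : R, 0 < s ->
  P ([set w | s <= enorm (theta n w - theta_oo w)] `&` Omega0) @[n --> \oo] --> 0%E.

Let measurable_field_oo j : measurable_fun setT (fun w => f (theta_oo w) ord0 j).
Proof.
have [c [lam [c0 lam0 Xgrowth]]] := second_moment hp XU.
apply: (measurableT_comp (measurable_field e0 a01 b01 f_adam (c := c) (lam := lam) Xgrowth j)).
exact: measurable_funPT.
Qed.

Let measurable_ge (g : Omega -> R) (s : R) : measurable_fun setT g ->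
  measurable [set w | s <= g w].
Proof.
move=> mg; have := measurable_fun_ler (@measurable_cst _ _ Omega _ setT s) mg.
by move=> /(_ measurableT [set true]); rewrite setTI; apply.
Qed.

(** The part of [Omega0] on which the limit is bounded by [rho] and the [j]-th
component of the vector field there is at least [delta] in absolute value. *)
Let bad j (rho delta : R) := [set w | enorm (theta_oo w) <= rho] `&`
  [set w | delta <= `|f (theta_oo w) ord0 j| ] `&` Omega0.

Let measurable_bad j rho delta : measurable (bad j rho delta).
Proof.
apply: measurableI => //; apply: measurableI.
  have mn : measurable_fun setT (fun w => - enorm (theta_oo w)).
    by apply: measurableT_comp => //; apply: measurable_fun_enorm; exact: measurable_funPT.
  rewrite (_ : [set w | _] = [set w | - rho <= - enorm (theta_oo w)]).
    exact: measurable_ge.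
  by apply/seteqP; split => w /=; rewrite lerN2.
by apply: measurable_ge; exact: measurableT_comp.
Qed.

(** On the bad event, either one of the ends of a window of mass about [eta] is far
from the limit, or the displacement of the process differs by at least
[delta * eta / 8] from the vector field times the mass of the window. *)
Let bad_null j rho delta : 0 <= rho -> 0 < delta -> P (bad j rho delta) = 0%E.
Proof.
move=> rho0 delta0.
suff small s : 0 < s -> (P (bad j rho delta) <= s%:E)%E.
  apply/eqP; rewrite -measure_le0; apply/lee_addgt0Pr => s s0.
  by rewrite add0e; exact: small.
move=> s0.
have [c [lam [c0 lam0 Xgrowth]]] := second_moment hp XU.
have r0 : 0 <= rho + 1 by rewrite addr_ge0.
have r1 : 0 <= rho + 1 + 1 by rewrite addr_ge0.
have [K K0 Xlip] := local_lipschitz hp XU r1.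
have [V [m [v [sigma [iidV init step]]]]] := theta_adam.
have [W [t0 [W0 weighted]]] := weighted_energy_bounded e0 a01 b01 gamma_gt0 gamma_cvg0
  iidV init step j lam0 c0 Xgrowth.
have tol0 : 0 < s * delta / 32 by rewrite divr_gt0// mulr_gt0.
have [eta eta0 Heta] := window_dist e0 a01 b01 gamma_gt0 gamma_decr gamma_cvg0
  iidV init step f_adam lam0 c0 Xgrowth K0 Xlip weighted tol0.
have [n0 Hn0] := Heta eta eta0 (lexx _).
have mtheta n : measurable_fun setT (theta n) := measurable_theta e0 init step n.
pose M := dirlip a b e ^+ 2 * K.
have M0 : 0 <= M by rewrite mulr_ge0// sqr_ge0.
have M1 : 0 < M + 1 by rewrite ltr_wpDl.
(* Closeness to the limit: so that [theta n] is in the ball of radius [rho + 1],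
that the displacement of the process is at most [delta * eta / 16], and that the
vector field varies by at most [delta / 2]. *)
pose q := Num.min 1 (Num.min (delta * eta / 32) (delta / (2 * (M + 1)))).
have q0 : 0 < q.
  rewrite !lt_min ltr01/=; apply/andP; split; first by rewrite divr_gt0// mulr_gt0.
  by rewrite divr_gt0// mulr_gt0.
have q1 : q <= 1 by rewrite ge_min lexx.
have q2 : q <= delta * eta / 32 by rewrite ge_min; apply/orP; right; rewrite ge_min lexx.
have q3 : q * (2 * (M + 1)) <= delta.
  by rewrite -ler_pdivlMr ?mulr_gt0//; rewrite !ge_min lexx !orbT.
have Mq : M * q ^+ 2 <= (delta / 2) ^+ 2.
  have h2 : (q * (2 * (M + 1))) ^+ 2 <= delta ^+ 2.
    by apply: lerXn2r; rewrite ?nnegrE ?(ltW delta0)// !mulr_ge0 ?(ltW q0) ?(ltW M1).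
  have h3 : 0 <= M * q ^+ 2 by rewrite mulr_ge0 ?sqr_ge0.
  have h4 : 0 <= (M * q) ^+ 2 by exact: sqr_ge0.
  have h5 := sqr_ge0 q.
  have : (q * (2 * (M + 1))) ^+ 2 = 4 * (M * q) ^+ 2 + 8 * (M * q ^+ 2) + 4 * q ^+ 2.
    by ring.
  lra.
pose A n := [set w | q <= enorm (theta n w - theta_oo w)] `&` Omega0.
have mA n : measurable (A n).
  apply: measurableI => //; apply: measurable_ge; apply: measurable_fun_enorm.
  apply/measurable_fun_rV => i.
  rewrite (_ : (fun w => _) = fun w => theta n w ord0 i - theta_oo w ord0 i).
    apply: measurable_funB; [move: i; apply/measurable_fun_rV; exact: mtheta|].
    by move: i; apply/measurable_fun_rV; exact: measurable_funPT.
  by apply/funext => w; rewrite !mxE.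
have [n1 HA] : exists n1, forall n, (n1 <= n)%N -> (P (A n) <= (s / 4)%:E)%E.
  have /fine_cvgP[_ /cvgr_le/(_ (s / 4))] := theta_cvg q0.
  rewrite divr_gt0// => /(_ isT)[n1 _ H]; exists n1 => n n1n.
  by rewrite -(fineK (fin_num_measure P _ (mA n))) lee_fin; exact: H.
have [n2 Hg] : exists n2, forall n, (n2 <= n)%N -> gamma n <= eta / 2.
  have [n2 H] := small_eventually 1 gamma_cvg0 (e := eta / 2) ltac:(by rewrite divr_gt0).
  by exists n2 => n /H; rewrite mul1r.
pose n := maxn n0 (maxn n1 n2).
have nn0 : (n0 <= n)%N by exact: leq_maxl.
have nn1 : (n1 <= n)%N by rewrite (leq_trans (leq_maxl n1 n2))// leq_maxr.
have nn2 : (n2 <= n)%N by rewrite (leq_trans (leq_maxr n1 n2))// leq_maxr.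
have [k [nk mass1 mass2]] := window_exists gamma_gt0 gamma_decr gamma_nonsummable
  eta0 (Hg n.+1 (leqW nn2)).
pose h w := `|inside theta (rho + 1) n w * (theta k w ord0 j - theta n w ord0 j
     - mass gamma n k * f (theta n w) ord0 j)|.
have mh : measurable_fun setT h.
  have mfn : measurable_fun setT (fun w => f (theta n w) ord0 j).
    by apply: (measurableT_comp (measurable_field e0 a01 b01 f_adam (c := c) (lam := lam) Xgrowth j)).
  have mco i : measurable_fun setT (fun w => theta i w ord0 j).
    exact: (measurableT_comp (@measurable_rV_coord R d j) (mtheta i)).
  apply: measurableT_comp => //; apply: measurable_funM.
    rewrite /inside; apply: (measurableT_comp (f := fun x : bool => x%:R : R)) => //.
    by apply: measurable_fun_ler => //; exact: measurable_fun_enorm.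
  apply: measurable_funB; first exact: measurable_funB.
  exact: measurable_funM.
pose D := [set w | delta * eta / 8 <= h w].
have mD : measurable D by exact: measurable_ge.
have PD : (P D <= (s / 4)%:E)%E.
  have x0 : 0 < delta * eta / 8 by rewrite divr_gt0// mulr_gt0.
  apply: (markov_le mh _ x0) => [w|]; first exact: normr_ge0.
  apply: le_trans (Hn0 n k nn0 nk mass2) _; rewrite lee_fin.
  by rewrite le_eqVlt; apply/orP; left; apply/eqP; field.
apply: (@le_trans _ _ (P (A n `|` A k `|` D))).
  apply: le_measure; rewrite ?inE//.
    by apply: measurableU => //; exact: measurableU.
  move=> w [[/= woo wf] wO].
  have [An|nAn] := pselect (A n w); first by left; left.
  have [Ak|nAk] := pselect (A k w); first by left; right.
  right; rewrite /D /=.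
  have dn : enorm (theta n w - theta_oo w) < q.
    by rewrite ltNge; apply/negP => qn; apply: nAn.
  have dk : enorm (theta k w - theta_oo w) < q.
    by rewrite ltNge; apply/negP => qk; apply: nAk.
  have tn : enorm (theta n w) <= rho + 1.
    apply: le_trans (enorm_le_dist _ (theta_oo w)) _; apply: lerD => //.
    by apply: le_trans q1; exact: ltW.
  rewrite /h /inside tn mul1r.
  have fdist : `|f (theta n w) ord0 j - f (theta_oo w) ord0 j| <= delta / 2.
    rewrite -(ler_pXn2r (n := 2)) ?nnegrE ?divr_ge0 ?(ltW delta0)//.
    rewrite real_normK ?num_real//; apply: le_trans Mq.
    have tn1 : enorm (theta n w) <= rho + 1 + 1 by apply: le_trans tn _; rewrite lerDl.
    have too1 : enorm (theta_oo w) <= rho + 1 + 1 by apply: le_trans woo _; lra.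
    apply: le_trans (field_lipschitz e0 a01 b01 f_adam Xgrowth j K0 Xlip tn1 too1) _.
    rewrite mulrA ler_wpM2l//; apply: lerXn2r; rewrite ?nnegrE ?enorm_ge0 ?(ltW q0)//.
    exact: ltW.
  have cn : `|theta n w ord0 j - theta_oo w ord0 j| <= q.
    apply: le_trans (ltW dn); have := normr_coord_le (theta n w - theta_oo w) j.
    by rewrite !mxE.
  have ck : `|theta k w ord0 j - theta_oo w ord0 j| <= q.
    apply: le_trans (ltW dk); have := normr_coord_le (theta k w - theta_oo w) j.
    by rewrite !mxE.
  set fn := f (theta n w) ord0 j in fdist *; set fo := f (theta_oo w) ord0 j in fdist wf *.
  have fn2 : delta / 2 <= `|fn|.
    have : `|fo| <= `|fo - fn| + `|fn| by rewrite -{1}(subrK fn fo) ler_normD.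
    by rewrite distrC; lra.
  set tn' := theta n w ord0 j in cn *; set tk := theta k w ord0 j in ck *.
  have knq : `|tk - tn'| <= q + q.
    have -> : tk - tn' = (tk - theta_oo w ord0 j) - (tn' - theta_oo w ord0 j) by ring.
    by apply: le_trans (ler_normB _ _) _; exact: lerD.
  set mass_nk := mass gamma n k in mass1 mass2 *.
  have mass0 : 0 <= mass_nk by exact: mass_ge0.
  have : mass_nk * `|fn| <= `|tk - tn' - mass_nk * fn| + `|tk - tn'|.
    rewrite -{1}(ger0_norm mass0) -normrM.
    have {1}-> : mass_nk * fn = - (tk - tn' - mass_nk * fn) + (tk - tn') by ring.
    by apply: le_trans (ler_normD _ _) _; rewrite normrN.
  have : eta / 2 * (delta / 2) <= mass_nk * `|fn|.
    by apply: ler_pM => //; rewrite divr_ge0// ltW.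
  lra.
apply: le_trans (measureU2 _ _ _) _ => //; first exact: measurableU.
apply: (@le_trans _ _ ((s / 4 + s / 4)%:E + (s / 4)%:E)%E).
  rewrite leeD//; apply: le_trans (measureU2 _ _ _) _ => //.
  by rewrite EFinD leeD// HA// (leq_trans nn1).
rewrite -EFinD lee_fin; lra.
Qed.

(** The event is a countable union of bad events, with integer radii [N] and
thresholds [1 / (N + 1)]. *)
Lemma adam_limit_null : P ([set w | f (theta_oo w) <> 0] `&` Omega0) = 0%E.
Proof.
pose F i := if @choice.unpickle ('I_d * nat)%type i is Some (j, N)
  then bad j N%:R (N.+1%:R)^-1 else set0.
have FP i : measurable (F i) /\ P (F i) = 0%E.
  rewrite /F; case: choice.unpickle => [[j N]|]; last by split; [exact: measurable0|exact: measure0].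
  by split; [exact: measurable_bad|apply: bad_null; rewrite ?invr_gt0].
have -> : [set w | f (theta_oo w) <> 0] `&` Omega0 = \bigcup_i F i.
  apply/seteqP; split => [w [/= fw wO]|w [i _]]; last first.
    rewrite /F; case: choice.unpickle => [[j N] [[_ /= fj] wO]|//]; split=> //= f0.
    by move: fj; rewrite f0 mxE normr0 leNgt invr_gt0 ltr0Sn.
  have [j fj] : exists j, f (theta_oo w) ord0 j != 0.
    apply: contrapT => nj; apply: fw; apply/rowP => j; rewrite mxE; apply/eqP.
    by apply/negPn/negP => fj; apply: nj; exists j.
  have fj0 : 0 < `|f (theta_oo w) ord0 j| by rewrite normr_gt0.
  pose N := (Num.truncn (enorm (theta_oo w) + `|f (theta_oo w) ord0 j|^-1)).+1.
  have NE : enorm (theta_oo w) + `|f (theta_oo w) ord0 j|^-1 <= N%:R.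
    by rewrite ltW// truncnS_gt.
  exists (choice.pickle (j, N)) => //; rewrite /F choice.pickleK; split => //; split=> /=.
    by apply: le_trans NE; rewrite lerDl invr_ge0.
  rewrite invf_ple ?posrE ?ltr0Sn//; apply: le_trans (_ : N%:R <= _); last first.
    by rewrite ler_nat.
  by apply: le_trans NE; rewrite lerDr enorm_ge0.
apply: measure_negligible; first by apply: bigcup_measurable => i _; exact: (FP i).1.
apply: negligible_bigcup => i; apply/negligibleP; first exact: (FP i).1.
exact: (FP i).2.
Qed.

End final.

Theorem corollary1p10 (R : realType)
  (epsilon alpha beta : R)
  (hepsilon : 0 < epsilon) (halpha : 0 <= alpha < 1)
  (hbeta : alpha ^+ 2 < beta < 1)
  (gamma : nat -> R)
  (gamma_gt0 : forall n, (1 <= n)%N -> 0 < gamma n)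
  (gamma_nonsummable : ~ cvgn (series (fun n => gamma n.+1)))
  (gamma_decr : forall m n, (1 <= m)%N -> (m <= n)%N -> gamma n <= gamma m)
  (gamma_cvg0 : gamma @ \oo --> (0 : R))
  (gamma_slow : (0 < ereal_sup [set limn_einf (fun n : nat =>
      ((gamma n)^-1 * gamma (n + `|Num.ceil ((gamma n)^-1 * e)%R|)%N)%R%:E)
      | e in [set e : R | (0 < e)%R]])%E)
  (p : R) (hp : 2 <= p)
  (d : nat) (hd : (1 <= d)%N) (vartheta : 'rV[R]_d)
  (dO : measure_display) (Omega : measurableType dO) (P : probability Omega R)
  (dS : measure_display) (S : measurableType dS)
  (X : {mfun (S * 'rV[R]_d)%type >-> 'rV[R]_d}) (U : {RV P >-> S})
  (XU_regular : locally_regular p X U)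
  (theta : nat -> Omega -> 'rV[R]_d)
  (theta_adam :
     adam_algorithm X U gamma alpha beta epsilon vartheta theta)
  (f : 'rV[R]_d -> 'rV[R]_d)
  (f_adam : adam_vector_field X U alpha beta epsilon f)
  (theta_oo : {RV P >-> 'rV[R]_d})
  (Omega0 : set Omega) (mOmega0 : measurable Omega0)
  (theta_cvg : forall e : R, 0 < e ->
     P ([set w | e <= enorm (theta n w - theta_oo w)] `&` Omega0)
       @[n --> \oo] --> 0%E) :
  P ([set w | f (theta_oo w) <> 0] `&` Omega0) = 0%E.
Proof.
exact: (adam_limit_null hepsilon halpha hbeta gamma_gt0 gamma_nonsummable gamma_decr
  gamma_cvg0 hp XU_regular theta_adam f_adam mOmega0 theta_cvg).
Qed.
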